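(* Let $n\ge 2$, let $K=\mathbb{R}$ or $K=\mathbb{C}$, and let $A\in M_n^*(K)$. The following are equivalent: (i) the matrix $A$ is Hermitian; (ii) the network $(T,F_{A,T})$ is Hermitian for some tiling $T$ of $P_n$; (iii) the network $(T,F_{A,T})$ is Hermitian for every tiling $T$ of $P_n$.
   Context: $[n]=\{1,\dots,n\}$; for a matrix $A$ and $X,Y\subseteq[n]$, $|X|=|Y|$, $A_X^Y$ is the submatrix with rows $X$ and columns $Y$ in increasing order; the empty determinant is 1. An almost-principal minor is $\det A_{S\cup\{i\}}^{S\cup\{j\}}$ with $i\neq j$, $i,j\notin S$; it is odd if $(i-j)(-1)^{|S|}>0$. For each $S$ and $i\ne j$ exactly one of $\det A_{S\cup\{i\}}^{S\cup\{j\}}$ and $\det A_{S\cup\{j\}}^{S\cup\{i\}}$ is odd. $M_n^*(K)$ is the set of generic $n\times n$ matrices over $K$: those all of whose principal minors and odd almost-principal minors are nonzero. Tilings: let $e_j=e^{\pi i(j-1)/n}\in\mathbb{R}^2$, and let $P_n$ be the regular $2n$-gon with unit edges which is the convex hull of $\{\sum_{j\in S}e_j:S\subseteq[n]\}$; $v_0=0$ is one of its vertices. A tiling $T$ of $P_n$ is a tiling by translates of the unit rhombi $R_{jk}$ ($j<k$) with edges parallel to $e_j,e_k$, each $R_{jk}$ occurring exactly once. Each vertex $v$ of $T$ corresponds to a subset $S\subseteq[n]$: the set of $j$ such that $e_j$ is a step of a shortest path along tiling edges from $v_0$ to $v$; then $v=\sum_{j\in S}e_j$ and the graph distance from $v_0$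 to $v$ is $|S|$. $U(T)$ is the set of vertices and faces (rhombi) of $T$. Put $\sigma(v)=(-1)^{\lfloor |S|/2\rfloor}$. A network is a pair $(T,F)$ with $T$ a tiling and $F:U(T)\to K$. For a matrix $A$, $F_{A,T}(v)=\sigma(v)\det A_S^S$ for a vertex $v$ corresponding to $S$, and for the rhombus with vertices $v,v+e_i,v+e_i+e_j,v+e_j$ with $v$ corresponding to $S$, $F_{A,T}$ equals $\sigma(v+e_i)$ times the odd one among $\det A_{S\cup\{j\}}^{S\cup\{i\}}$, $\det A_{S\cup\{i\}}^{S\cup\{j\}}$. A network $(T,F)$ is Hermitian if $F(v)$ is real for all vertices $v$ and, for each face $f$ with vertices $a,b,c,d$ in cyclic order, $|F(f)|^2=F(a)F(c)+F(b)F(d)$. *)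

(* Defs.v *)
From HB Require Import structures.
From mathcomp Require Import all_boot all_order all_algebra.
From mathcomp Require Import all_classical all_reals all_analysis.
From mathcomp Require Import complex.
Import Order.TTheory GRing.Theory Num.Theory.
Import numFieldNormedType.Exports.

Set Implicit Arguments.
Unset Strict Implicit.
Unset Printing Implicit Defensive.

Local Open Scope classical_set_scope.
Local Open Scope ring_scope.

(* Indices run over 'I_n = {0, ..., n-1} instead of {1, ..., n}. Only
   differences i - j and the direction e_j (whose angle is therefore
   pi * j / n) are affected. *)

Section Minors.
Variables (K : comPzRingType) (n : nat).
Implicit Types (A : 'M[K]_n) (S X Y : {set 'I_n}) (i j : 'I_n).

(* [enum] lists a set of ordinals in increasing order. Only meaningful for
   #|X| = #|Y|; the default value of [nth] is then never used. *)
Definition minor A X Y : K :=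
  \det (\matrix_(a < #|X|, b < #|X|) A (enum_val a) (nth (enum_val a) (enum Y) b)).

(* Parity of the almost-principal minor with rows S + i and columns S + j. *)
Definition odd_index S i j : bool :=
  (0 < (i%:Z - j%:Z) * (-1) ^+ #|S| :> int).

Definition odd_minor A S i j : K :=
  if odd_index S i j then minor A (i |: S) (j |: S)
  else minor A (j |: S) (i |: S).

Definition generic A : Prop :=
  (forall S, minor A S S != 0) /\
  (forall S i j, i \notin S -> j \notin S -> i != j -> odd_index S i j ->
     minor A (i |: S) (j |: S) != 0).

End Minors.

Section Geometry.
Variables (R : realType) (n : nat).
Notation plane := 'rV[R]_2.

Definition dir (j : 'I_n) : plane :=
  \row_(c < 2) (if c == 0 then cos (pi * j%:R / n%:R) else sin (pi * j%:R / n%:R)).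

Definition convex_hull (X : set plane) : set plane := smallest (@convex_set R plane) X.

Definition polygon : set plane :=
  convex_hull (range (fun S : {set 'I_n} => \sum_(j in S) dir j)).

(* Index pairs j < k of the rhombi R_jk; also the faces of a tiling. *)
Definition face := {p : 'I_n * 'I_n | (p.1 < p.2)%N}.
Definition fst_dir (f : face) : 'I_n := (val f).1.
Definition snd_dir (f : face) : 'I_n := (val f).2.

Definition rhombus (f : face) (t : plane) : set plane :=
  [set x | exists a b : R, [/\ 0 <= a <= 1, 0 <= b <= 1 &
     x = t + a *: dir (fst_dir f) + b *: dir (snd_dir f)]].

(* Each R_jk is used exactly once, so a tiling is given by the position of
   the corner v of each R_jk with corners v, v+e_j, v+e_j+e_k, v+e_k. *)
Record tiling := Tiling {
  pos : face -> plane;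
  tiling_cover : \bigcup_(f in setT) rhombus f (pos f) = polygon;
  tiling_disjoint : forall f g : face, f != g ->
    (rhombus f (pos f))° `&` (rhombus g (pos g))° = set0
}.

Variable T : tiling.

Definition corner_pt (f : face) (a b : bool) : plane :=
  pos T f + a%:R *: dir (fst_dir f) + b%:R *: dir (snd_dir f).

Definition is_vertex (x : plane) : Prop := exists f a b, x = corner_pt f a b.

Definition vertex := {x : plane | is_vertex x}.

Definition corner (f : face) (a b : bool) : vertex :=
  exist _ (corner_pt f a b) (ex_intro _ f (ex_intro _ a (ex_intro _ b erefl))).

(* Two corners of one rhombus are joined by an edge when exactly one of their
   two coordinates differs. *)
Definition tiling_edge (x y : plane) : Prop :=
  exists f a b a' b', [/\ x = corner_pt f a b, y = corner_pt f a' b' &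
    (a != a') (+) (b != b')].

(* The walk visits 0 and then the points of s. *)
Definition walk_to (x : plane) (s : seq plane) : Prop :=
  path (fun y z => `[< tiling_edge y z >]) 0 s /\ last 0 s = x.

Definition shortest_walk_to (x : plane) (s : seq plane) : Prop :=
  walk_to x s /\ forall s', walk_to x s' -> (size s <= size s')%N.

Definition has_step (s : seq plane) (u : plane) : Prop :=
  exists2 m, (m < size s)%N & nth 0 s m = nth 0 (0 :: s) m + u.

Definition vertex_set (v : vertex) : {set 'I_n} :=
  [set j | `[< exists2 s, shortest_walk_to (sval v) s & has_step s (dir j) >]]%SET.

Definition U : Type := (vertex + face)%type.

End Geometry.

Section Networks.
Variables (R : realType) (K : numDomainType) (n : nat).

Definition sigma (T : tiling R n) (v : vertex T) : K :=
  (-1) ^+ (#|vertex_set v| %/ 2).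

Definition network_of (A : 'M[K]_n) (T : tiling R n) (u : U T) : K :=
  match u with
  | inl v => sigma v * minor A (vertex_set v) (vertex_set v)
  | inr f => sigma (corner T f true false) *
      odd_minor A (vertex_set (corner T f false false)) (fst_dir f) (snd_dir f)
  end.

(* When K is a real field the reality condition is automatic and `|_| is the
   absolute value; when K = R[i], `|_| is the complex modulus. *)
Definition hermitian_network (T : tiling R n) (F : U T -> K) : Prop :=
  (forall v : vertex T, F (inl v) \is Num.real) /\
  (forall f : face n,
     `|F (inr f)| ^+ 2 =
       F (inl (corner T f false false)) * F (inl (corner T f true true)) +
       F (inl (corner T f true false)) * F (inl (corner T f false true))).

End Networks.

(* Main.v *)
Require Import Defs.
From HB Require Import structures.
From mathcomp Require Import all_boot all_order all_algebra all_fingroup.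
From mathcomp Require Import ring lra zify.
Import Order.TTheory GRing.Theory Num.Theory.

(** Write A_S^T for the submatrix with rows S and columns T, and A^* for the
    (conjugate) transpose of A. The proof has an algebraic part, which needs
    nothing but the combinatorics of the vertex sets of a tiling, and a
    geometric part, which provides this combinatorics.

    Algebra. For j not in S, Gauss elimination yields a unique vector f_(S,j)
    in e_j + span(e_b, b in S) such that A f_(S,j) vanishes on S ([pivot]),
    and the entries g_S(i,j) = (A f_(S,j))_i are those of the Schur complement
    of A_S^S ([schur]). The minor with rows S + i and columns S + j equals
    det A_S^S g_S(i,j) up to a sign that is symmetric in i and j
    ([minor_schur]), hence the Desnanot-Jacobi identity [jacobi]. Because of it
    and of the signs sigma, the condition on a face with lowest vertex S and
    directions j, k says that the odd minor has squared modulus equal to the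
    product of the two almost-principal minors. As the odd minor is nonzero,
    this means that g_S(j,k) and g_S(k,j) are conjugate ([face_conditionP]).
    Since g_S(j,k) for A^* is the conjugate of g_S(k,j) for A
    ([schur_adjoint]), a Hermitian matrix has Hermitian networks.

    Conversely, let the network of A on one tiling be Hermitian. Attach to
    each edge from S to S + j of the tiling the vector f_(S,j) of A and the
    corresponding vector f'_(S,j) of A^*. Across a rhombus,
      f_(S+k,j) = f_(S,j) - (g_S(k,j) / g_S(k,k)) f_(S,k)    ([pivot_step]),
    and the coefficients for A and A^* agree. Let M be the linear map that
    sends f to f' on the edges of the right boundary of the polygon. Sweeping
    the tiling from right to left, M sends f to f' on all edges. On the right
    boundary the vectors are e_j + span(e_b, b < j), on the left boundary they
    are e_j + span(e_b, b > j), so that M is unitriangular in both senses and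
    M = 1. Thus A and A^* have the same vectors on the right boundary. Let U be
    the matrix with these columns. Then A U and A^* U are lower triangular with
    the same diagonal, so U^* (A - A^* ) U is strictly lower triangular and
    skew-Hermitian, that is, zero ([hermitian_of_sweep]).

    Geometry. Tilings are only given as coverings with disjoint interiors, and
    the e_j can be linearly dependent over the rationals, so that a vertex
    does not determine its set as a point. Fix a direction i. Counting
    the rhombi that contain a point, made half open towards directions slightly
    to the left and slightly to the right of e_i, leaves only the edges parallel
    to e_i, and the result depends on the polygon alone. Comparison with a
    standard tiling ([std_tiling_exists]) shows that the rhombi with an edge e_i
    fit together, edge to edge, to a strip from the right to the left boundary
    ([strip_perm]). The position of a point x relative to this strip is a
    continuous function ([offset]) which is the i-th coordinate inside the
    strip and avoids ]0, 1[ in the interior of all other rhombi. By the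
    intermediate value theorem each of these lies on one side of the strip, so
    that the set [label x] of the strips below x is consistent among all rhombi
    with corner x ([label_corner]). Each edge of the tiling changes the
    label by its own direction, and every vertex can be reached from 0 by a
    walk that never goes down, so the label is the set of the steps of a
    shortest walk ([vertex_setE]). *)

Set Implicit Arguments.
Unset Strict Implicit.
Unset Printing Implicit Defensive.
Local Open Scope ring_scope.

(** * Bordered minors and Schur complements *)

Section Minors.
Variables (K : fieldType) (n : nat).
Implicit Types (A : 'M[K]_n) (S X Y : {set 'I_n}) (i j k : 'I_n).

Lemma minor_nth A X Y m x0 : #|X| = m -> #|Y| = m ->
  minor A X Y =
  \det (\matrix_(a < m, b < m) A (nth x0 (enum X) a) (nth x0 (enum Y) b)).
Proof.
move=> <- cXY; congr (\det _); apply/matrixP => a b; rewrite !mxE.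
congr (A _ _); first by apply: set_nth_default; rewrite -cardE.
by apply: set_nth_default; rewrite -cardE cXY.
Qed.

(** The parity needed to sort S followed by i. It depends on S and i only, so
    that these signs cancel when rows and columns are exchanged. *)
Definition insertion_sign S i : bool :=
  odd_perm (odflt 1%g [pick p : 'S_(#|S|.+1) |
    [forall a : 'I_(#|S|.+1),
      nth i (enum (i |: S)) (p a) == nth i (rcons (enum S) i) a]]).

Lemma insertion_signP S i : i \notin S ->
  exists2 p : 'S_(#|S|.+1), odd_perm p = insertion_sign S i &
    forall a, nth i (enum (i |: S)) (p a) = nth i (rcons (enum S) i) a.
Proof.
move=> iS; rewrite /insertion_sign.
case: pickP => [p /forallP hp | no] /=.
  by exists p => // a; apply/eqP.
have sz1 : size (rcons (enum S) i) = #|S|.+1 by rewrite size_rcons -cardE.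
have sz2 : size (enum (i |: S)) = #|S|.+1 by rewrite -cardE cardsU1 iS.
have perm : perm_eq (rcons (enum S) i) (enum (i |: S)).
  apply: uniq_perm; first by rewrite rcons_uniq enum_uniq mem_enum iS.
    exact: enum_uniq.
  by move=> x; rewrite mem_rcons in_cons !mem_enum in_setU1.
have [sz1b sz2b] := (introT eqP sz1, introT eqP sz2).
have /tuple_permP[p /= hp] : perm_eq (Tuple sz1b) (Tuple sz2b) by [].
suff: false by []; rewrite -(no p); apply/forallP => a; apply/eqP.
rewrite hp (nth_map a) ?size_enum_ord // nth_ord_enum.
by rewrite (tnth_nth i).
Qed.

Lemma minor_bordered A S i j : i \notin S -> j \notin S ->
  minor A (i |: S) (j |: S) =
  (-1) ^+ (insertion_sign S i (+) insertion_sign S j) *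
  \det (\matrix_(a < #|S|.+1, b < #|S|.+1)
     A (nth i (rcons (enum S) i) a) (nth j (rcons (enum S) j) b)).
Proof.
move=> iS jS; have [p <- hp] := insertion_signP iS.
have [q <- hq] := insertion_signP jS.
have cS k : k \notin S -> #|k |: S| = #|S|.+1 by move=> kS; rewrite cardsU1 kS.
rewrite (minor_nth A i (cS _ iS) (cS _ jS)).
set M := \matrix_(a, b) _; set N := \matrix_(a, b) _.
have -> : N = row_perm p (col_perm q M).
  apply/matrixP => a b; rewrite !mxE -hp -hq; congr (A _ _).
  by apply: set_nth_default; rewrite -cardE cS.
rewrite row_permE col_permE !det_mulmx !det_perm odd_permV.
by case: (odd_perm p); case: (odd_perm q); rewrite /= ?expr0 ?expr1; ring.
Qed.

Lemma minorSS A S : minor A S S =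
  \det (\matrix_(a < #|S|, b < #|S|) A (enum_val a) (enum_val b)).
Proof.
congr (\det _); apply/matrixP => a b; rewrite !mxE.
by rewrite [X in _ = A _ X](enum_val_nth (enum_val a)).
Qed.

(** Gauss elimination of column j of A by its columns in S: the combination of
    the e_b with b in S is chosen such that the rows of A in S annihilate the
    result. *)
Definition pivot A S j : 'cV[K]_n :=
  let x := invmx (\matrix_(a < #|S|, b < #|S|) A (enum_val a) (enum_val b))
             *m (\col_a A (enum_val a) j) in
  delta_mx j 0 - \sum_b x b 0 *: delta_mx (enum_val b) 0.

Definition schur A S i j : K := (A *m pivot A S j) i 0.

Lemma sum_support S (F : 'I_n -> K) : (forall i, i \notin S -> F i = 0) ->
  \sum_i F i = \sum_(b < #|S|) F (enum_val b).
Proof.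
move=> F0; rewrite -big_enum_val /= [RHS]big_mkcond /=; apply: eq_bigr => i _.
by case: ifP => // /negbT /F0.
Qed.

(** Restricted to S, the vector v is in the kernel of the invertible A_S^S. *)
Lemma regular_supported A S (v : 'cV[K]_n) : minor A S S != 0 ->
  (forall i, i \notin S -> v i 0 = 0) ->
  (forall b, b \in S -> (A *m v) b 0 = 0) -> v = 0.
Proof.
rewrite minorSS; set M := \matrix_(a, b) _ => dM v0 Av.
have uM : M \in unitmx by rewrite unitmxE unitfE.
have : M *m (\col_b v (enum_val b) 0) = 0.
  apply/matrixP => a z; rewrite mxE [RHS]mxE -[RHS](Av (enum_val a) (enum_valP a)).
  rewrite mxE (sum_support (S := S)) => [|i iS]; last by rewrite v0 ?mulr0.
  by apply: eq_bigr => b _; rewrite !mxE.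
move/(congr1 (mulmx (invmx M))); rewrite mulKmx // mulmx0 => v'0.
apply/matrixP => i z; rewrite ord1 mxE; have [iS|/v0//] := boolP (i \in S).
have := congr1 (fun w : 'cV_ _ => w (enum_rank_in iS i) 0) v'0.
by rewrite !mxE enum_rankK_in.
Qed.

Lemma pivot_diag A S j : j \notin S -> pivot A S j j 0 = 1.
Proof.
move=> jS; rewrite !mxE !eqxx summxE big1 ?subr0 // => b _; rewrite !mxE.
case: eqP => [jb|]; last by rewrite mulr0.
by move: jS; rewrite jb enum_valP.
Qed.

Lemma pivot_out A S j i : i \notin j |: S -> pivot A S j i 0 = 0.
Proof.
rewrite in_setU1 negb_or => /andP[ij iS].
rewrite !mxE (negPf ij) summxE big1 ?subr0 // => b _; rewrite !mxE.
case: eqP => [jb|]; last by rewrite mulr0.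
by move: iS; rewrite jb enum_valP.
Qed.

Lemma schur_in A S i j : minor A S S != 0 -> i \in S -> schur A S i j = 0.
Proof.
rewrite minorSS => dM iS; rewrite /schur /pivot.
set M := \matrix_(a, b) _; set c := \col_a _.
have uM : M \in unitmx by rewrite unitmxE unitfE.
set x := invmx M *m c; have Mx : M *m x = c by rewrite mulKVmx.
rewrite mulmxBr mxE [X in _ + X]mxE mulmx_sumr summxE -colE mxE.
have -> : \sum_b (A *m (x b 0 *: delta_mx (enum_val b) 0) : 'cV_n) i 0
        = (M *m x) (enum_rank_in iS i) 0.
  rewrite [RHS]mxE; apply: eq_bigr => b _.
  by rewrite -scalemxAr -colE !mxE enum_rankK_in // mulrC.
by rewrite Mx mxE enum_rankK_in // subrr.
Qed.

(** Recursions for the pivot vectors can be checked entry by entry by means of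
    this characterization. *)
Lemma pivot_unique A S j (f : 'cV[K]_n) : minor A S S != 0 -> j \notin S ->
  f j 0 = 1 -> (forall i, i \notin j |: S -> f i 0 = 0) ->
  (forall b, b \in S -> (A *m f) b 0 = 0) -> f = pivot A S j.
Proof.
move=> mS jS fj f0 Af; apply/eqP; rewrite -subr_eq0; apply/eqP.
apply: (regular_supported mS) => [i iS|b bS].
  rewrite mxE [X in _ + X]mxE; have [->|ij] := eqVneq i j.
    by rewrite pivot_diag // fj subrr.
  have iU : i \notin j |: S by rewrite in_setU1 negb_or ij.
  by rewrite pivot_out // f0 // subrr.
by rewrite mulmxBr mxE [X in _ + X]mxE -/(schur _ _ _ _) schur_in // Af // subrr.
Qed.

(** Column operations turn the bordered matrix into a block triangular one
    with the Schur complement in its last corner. *)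
Lemma minor_schur A S i j : minor A S S != 0 -> i \notin S -> j \notin S ->
  minor A (i |: S) (j |: S) =
  (-1) ^+ (insertion_sign S i (+) insertion_sign S j) *
  (minor A S S * schur A S i j).
Proof.
move=> mS iS jS; rewrite minor_bordered //; congr (_ * _).
set N := \matrix_(a, b) _.
pose M : 'M[K]_#|S| := \matrix_(a, b) A (enum_val a) (enum_val b).
pose c : 'cV[K]_#|S| := \col_a A (enum_val a) j.
pose r : 'rV[K]_#|S| := \row_b A i (enum_val b).
pose f : 'cV[K]_#|S| := \col_b pivot A S j (enum_val b) 0.
pose d : 'cV[K]_1 := (A i j)%:M.
have e1 : #|S|.+1 = (#|S| + 1)%N by rewrite addn1.
have NE : castmx (e1, e1) N = block_mx M c r d.
  apply/matrixP => a b; rewrite castmxE !mxE !nth_rcons -!cardE /=.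
  have entry k (x : 'I_#|S|) : nth k (enum S) x = enum_val x.
    by rewrite (enum_val_nth k).
  case: (splitP a) => a' /= ->; rewrite ?ltn_ord ?(ord1 a') ?addn0 ?ltnn ?eqxx;
    rewrite ?mxE ?entry; case: (splitP b) => b' /= ->;
    by rewrite ?ltn_ord ?(ord1 b') ?addn0 ?ltnn ?eqxx ?entry ?mxE ?eqxx.
have -> : \det N = \det (block_mx M c r d).
  by rewrite -NE; case: _ / e1 {NE} => /=; rewrite castmx_id.
have sumf g : \sum_y A g y * pivot A S j y 0 =
    \sum_(b < #|S|) A g (enum_val b) * f b 0 + A g j.
  rewrite (bigD1 j) //= pivot_diag // mulr1 addrC; congr (_ + _).
  rewrite big_mkcond /= (sum_support (S := S)) => [|y yS].
    apply: eq_bigr => b _; rewrite [f b 0]mxE.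
    have -> : enum_val b != j by apply: contraNneq jS => <-; exact: enum_valP.
    by [].
  case: ifP => // yj; rewrite pivot_out ?mulr0 //.
  by rewrite in_setU1 negb_or yj.
have -> : \det (block_mx M c r d) =
  \det (block_mx M c r d *m block_mx 1%:M f 0 1%:M).
  by rewrite det_mulmx det_ublock !det1 !mulr1.
rewrite mulmx_block !mulmx1 !mulmx0 !addr0.
have -> : M *m f + c = 0.
  apply/matrixP => a z; rewrite ord1 [RHS]mxE.
  transitivity (schur A S (enum_val a) j); last exact/schur_in/enum_valP.
  rewrite /schur [RHS]mxE sumf mxE [c _ _]mxE mxE; congr (_ + _).
  by apply: eq_bigr => b _; rewrite [M _ _]mxE.
rewrite det_lblock -minorSS; congr (_ * _).
rewrite det_mx11 /schur [RHS]mxE sumf mxE [d 0 0]mxE eqxx mulr1n mxE.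
by congr (_ + _); apply: eq_bigr => b _; rewrite [r _ _]mxE.
Qed.

Lemma minorU1 A S i : minor A S S != 0 -> i \notin S ->
  minor A (i |: S) (i |: S) = minor A S S * schur A S i i.
Proof. by move=> mS iS; rewrite minor_schur // addbb mul1r. Qed.

End Minors.

(** * Elimination across a rhombus *)

Section Steps.
Variables (K : fieldType) (n : nat).
Implicit Types (A : 'M[K]_n) (S : {set 'I_n}) (i j k : 'I_n).

Lemma schur_neq0 A S k : minor A S S != 0 -> minor A (k |: S) (k |: S) != 0 ->
  k \notin S -> schur A S k k != 0.
Proof. by move=> mS mk kS; apply: contraNneq mk; rewrite minorU1 // => ->; rewrite mulr0. Qed.

(** Eliminating one more column k means subtracting the multiple of [pivot A S k]
    that makes row k vanish, since the rows in S vanish already. In a tiling this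
    relates the vectors attached to three edges of a rhombus with lowest vertex S
    and directions j, k. *)
Lemma pivot_step A S j k : minor A S S != 0 -> minor A (k |: S) (k |: S) != 0 ->
  j \notin S -> k \notin S -> j != k ->
  pivot A (k |: S) j =
  pivot A S j - (schur A S k j / schur A S k k) *: pivot A S k.
Proof.
move=> mS mk jS kS jk; have Gk := schur_neq0 mS mk kS.
have jkS : j \notin k |: S by rewrite in_setU1 negb_or jk.
apply/esym/pivot_unique => // [|i|b].
- by rewrite mxE [X in _ + X]mxE [X in - X]mxE pivot_diag // pivot_out // mulr0 subr0.
- rewrite !in_setU1 !negb_or => /and3P[ij ik iS].
  by rewrite mxE [X in _ + X]mxE [X in - X]mxE !pivot_out ?mulr0 ?subr0 // in_setU1
    negb_or ?ij ?ik.
- rewrite in_setU1 => bkS; rewrite mulmxBr -scalemxAr.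
  have -> (u v : 'cV[K]_n) c : (u - c *: v) b 0 = u b 0 - c * v b 0 by rewrite !mxE.
  rewrite -/(schur A S b j) -/(schur A S b k).
  case/predU1P: bkS => [->|bS]; first by rewrite divfK // subrr.
  by rewrite !(schur_in _ mS bS) mulr0 subr0.
Qed.

Lemma schur_step A S i j k : minor A S S != 0 -> minor A (k |: S) (k |: S) != 0 ->
  j \notin S -> k \notin S -> j != k ->
  schur A (k |: S) i j = schur A S i j - schur A S k j / schur A S k k * schur A S i k.
Proof.
move=> mS mk jS kS jk; rewrite /schur [in LHS]pivot_step // mulmxBr -scalemxAr.
by rewrite mxE [X in _ + X]mxE [X in - X]mxE.
Qed.

(** The Desnanot-Jacobi identity: if g denotes the Schur complement of A_S^S,
    the right-hand side is
      (det A_S^S)^2 (g_ii g_jj - g_ii (g_jj - g_ij g_ji / g_ii)). *)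
Lemma jacobi A S i j : minor A S S != 0 -> minor A (i |: S) (i |: S) != 0 ->
  i \notin S -> j \notin S -> i != j ->
  minor A (i |: S) (j |: S) * minor A (j |: S) (i |: S) =
  minor A (i |: S) (i |: S) * minor A (j |: S) (j |: S) -
  minor A S S * minor A (j |: (i |: S)) (j |: (i |: S)).
Proof.
move=> mS mi iS jS ij; have Gi := schur_neq0 mS mi iS.
have jiS : j \notin i |: S by rewrite in_setU1 negb_or eq_sym ij.
have ji : j != i by rewrite eq_sym.
rewrite (minorU1 mi jiS) (schur_step _ mS mi jS iS ji) !minor_schur // !addbb.
case: (insertion_sign S i); case: (insertion_sign S j); rewrite /= ?expr1 ?expr0; field; exact: Gi.
Qed.

End Steps.

(** * Schur complements of the adjoint matrix *)

Section Adjoint.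
Variables (K : fieldType) (cj : {rmorphism K -> K}) (cjK : involutive cj) (n : nat).
Implicit Types (A : 'M[K]_n) (S : {set 'I_n}) (i j k : 'I_n).

(** The involution cj is the identity for symmetric matrices and complex
    conjugation for Hermitian ones. *)
Definition adjoint A : 'M[K]_n := (map_mx cj A)^T.

Lemma adjointK A : adjoint (adjoint A) = A.
Proof. by apply/matrixP => i j; rewrite !mxE cjK. Qed.

Lemma minor_adjoint A S : minor (adjoint A) S S = cj (minor A S S).
Proof.
rewrite !minorSS -det_map_mx -det_tr; congr (\det _).
by apply/matrixP => a b; rewrite !mxE.
Qed.

Lemma pair_pivot A S k (w : 'cV[K]_n) : k \notin S ->
  (forall b, b \in S -> w b 0 = 0) ->
  \sum_x cj (pivot A S k x 0) * w x 0 = w k 0.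
Proof.
move=> kS wS; rewrite (bigD1 k) //= pivot_diag // rmorph1 mul1r big1 ?addr0 // => x xk.
have [/wS->|xS] := boolP (x \in S); first by rewrite mulr0.
by rewrite pivot_out ?rmorph0 ?mul0r // in_setU1 negb_or xk.
Qed.

(** Up to conjugation, both sides are the value of the sesquilinear form with
    matrix A at the pivot vectors of A for j and of its adjoint for k: all
    other contributions vanish because the pivot vectors are supported on
    S + j and S + k, while A and its adjoint send them to vectors vanishing on
    S. *)
Lemma schur_adjoint A S j k : minor A S S != 0 -> j \notin S -> k \notin S ->
  schur (adjoint A) S j k = cj (schur A S k j).
Proof.
move=> mS jS kS.
have mS' : minor (adjoint A) S S != 0 by rewrite minor_adjoint fmorph_eq0.
rewrite /schur.
rewrite -(pair_pivot (adjoint A) (w := A *m pivot A S j) kS); last first.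
  by move=> b bS; apply: (schur_in j mS bS).
rewrite -(pair_pivot A (w := adjoint A *m pivot (adjoint A) S k) jS); last first.
  by move=> b bS; apply: (schur_in k mS' bS).
have mulE (B : 'M[K]_n) (v : 'cV[K]_n) x : (B *m v) x 0 = \sum_y B x y * v y 0.
  by rewrite mxE.
under eq_bigr do rewrite mulE mulr_sumr.
under [X in cj X]eq_bigr do rewrite mulE mulr_sumr.
rewrite rmorph_sum /= exchange_big /=; apply: eq_bigr => x _.
rewrite rmorph_sum /=; apply: eq_bigr => y _.
by rewrite !rmorphM /= cjK [adjoint A _ _]mxE [map_mx _ _ _ _]mxE; ring.
Qed.

End Adjoint.

(** * The order in which a tiling is swept *)

Section SweepOrder.
Variable n : nat.
Implicit Types (S B : {set 'I_n}) (i j k : 'I_n).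

Local Open Scope nat_scope.

(** The leading digit at which two numbers in base 3 differ decides. *)
Lemma ltn_base3 m (d d' : 'I_m -> nat) (y : 'I_m) :
  (forall x : 'I_m, d x <= 2) -> (forall x : 'I_m, y < x -> d x = d' x) -> d y < d' y ->
  \sum_(x < m) d x * 3 ^ x < \sum_(x < m) d' x * 3 ^ x.
Proof.
elim: m => [|m IH] in d d' y *; first by case: y.
move=> d2 dd' dy; rewrite !big_ord_recr /=.
have low : \sum_(x < m) d (widen_ord (leqnSn m) x) * 3 ^ x < 3 ^ m.
  elim: m {IH dd' dy y d'} d d2 => [|m IH] d d2; first by rewrite big_ord0.
  rewrite big_ord_recr /= expnS.
  have := IH (d \o widen_ord (leqnSn m.+1)) (fun x => d2 _).
  set s := (X in X < _); set s' := (X in X + _).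
  have -> : s' = s by apply: eq_bigr => x _; congr (d _ * _); apply: val_inj.
  have := d2 (widen_ord (leqnSn m.+1) ord_max); nia.
case: (unliftP ord_max y) => [y' yE|yE].
  have -> : d ord_max = d' ord_max by apply: dd'; rewrite yE [(lift _ _ : nat)]lift_max ltn_ord.
  rewrite ltn_add2r.
  have yw : y = widen_ord (leqnSn m) y' by apply: val_inj; rewrite yE; exact: lift_max.
  apply: (IH (d \o widen_ord (leqnSn m)) (d' \o widen_ord (leqnSn m)) y') => [x|x yx|] /=.
  - exact: d2.
  - by apply: dd'; rewrite yw.
  - by rewrite -yw.
rewrite -yE; have := leq_mul dy (leqnn (3 ^ m)); rewrite mulSn.
by move=> dp; apply: leq_trans (leq_addl _ _); rewrite (leq_trans _ dp) // ltn_add2r.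
Qed.

(** A tiling can be swept from right to left, one rhombus at a time, because a rank
    of its edges increases whenever a rhombus is crossed. The rank of the edge
    from B to B + i is a function of B and i, the same for all tilings. In base 3,
    a direction above i has the digit 2 or 0 according as it is in B or not, i
    itself has the digit 1 in between, and below i the directions that are not
    in B count. *)
Definition sweep_digit B i (x : 'I_n) : nat :=
  if i < x then (x \in B).*2 else if x == i then 1 else x \notin B.
Definition sweep_rank B i : nat := \sum_x sweep_digit B i x * 3 ^ x.

Lemma sweep_digit_le2 B i x : sweep_digit B i x <= 2.
Proof. by rewrite /sweep_digit; do 2?case: ifP => //; case: (_ \in _). Qed.

(** In a rhombus with lowest vertex S and directions j < k, the edges (S, j) and
    (S + j, k) are on the right, the edges (S, k) and (S + k, j) on the left. *)
Lemma sweep_rank_face S j k : j < k -> j \notin S -> k \notin S ->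
  [/\ sweep_rank S j < sweep_rank S k, sweep_rank S j < sweep_rank (k |: S) j,
      sweep_rank (j |: S) k < sweep_rank S k &
      sweep_rank (j |: S) k < sweep_rank (k |: S) j].
Proof.
move=> jk jS kS.
split; [apply: (@ltn_base3 _ _ _ k) | apply: (@ltn_base3 _ _ _ k) |
        apply: (@ltn_base3 _ _ _ j) | apply: (@ltn_base3 _ _ _ k)];
  do ?[by move=> *; exact: sweep_digit_le2];
  rewrite /sweep_digit ?in_setU1 ?eqxx ?ltnn ?jk ?(negPf jS) ?(negPf kS) //=.
- by move=> x kx; rewrite kx (ltn_trans jk kx).
- by move=> x kx; rewrite (ltn_trans jk kx) in_setU1 -[x == k]val_eqE (gtn_eqF kx).
- by move=> x jx; rewrite in_setU1 -[x == j]val_eqE (gtn_eqF jx).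
- have -> : (k < j) = false by rewrite ltnNge (ltnW jk).
  by rewrite -val_eqE (ltn_eqF jk).
- by move=> x kx; rewrite !in_setU1 kx (ltn_trans jk kx) -![x == _]val_eqE
    (gtn_eqF kx) (gtn_eqF (ltn_trans jk kx)).
Qed.
End SweepOrder.

(** * Hermitian faces along a sweep force a Hermitian matrix *)

Section Converse.
Variables (K : fieldType) (cj : {rmorphism K -> K}) (cjK : involutive cj) (n : nat).
Implicit Types (S B : {set 'I_n}) (i j k : 'I_n).

(** Modulo the vectors e_b with b of smaller rank, which M is already known to
    fix up to terms of smaller rank, column j of both F and G is e_j. *)
Lemma unitriangular_id (M F G : 'M[K]_n) (rk : 'I_n -> nat) :
  (forall j, F j j = 1) -> (forall j, G j j = 1) ->
  (forall i j, i != j -> (rk j <= rk i)%N -> F i j = 0) ->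
  (forall i j, i != j -> (rk j <= rk i)%N -> G i j = 0) ->
  M *m F = G -> forall i j, (rk j <= rk i)%N -> M i j = (i == j)%:R.
Proof.
move=> F1 G1 F0 G0 MF i j; move: {2}(rk j) (leqnn (rk j)) => N.
elim: N j i => [|N IH] j i jN ji.
  all: have := congr1 (fun H : 'M_n => H i j) MF; rewrite mxE (bigD1 j) //= F1 mulr1.
  all: rewrite big1 ?addr0 => [->|b bj].
  1, 3: by have [->|ij] := eqVneq i j; [exact: G1 | exact: G0].
  by rewrite F0 ?mulr0 // (leq_trans jN).
have [jb|bj'] := leqP (rk j) (rk b); first by rewrite F0 ?mulr0.
have bN : (rk b <= N)%N by rewrite -ltnS (leq_trans bj').
have bi : (rk b <= rk i)%N := leq_trans (ltnW bj') ji.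
rewrite (IH b i bN bi).
case: eqP => [ib|]; last by rewrite mul0r.
by move: bj'; rewrite -ib ltnNge ji.
Qed.

Variable A : 'M[K]_n.
Hypothesis A_nz : forall S, minor A S S != 0.

(** What the conditions on a Hermitian network say about a face with lowest vertex
    S and directions j, k. *)
Definition hermitian_face S j k :=
  [/\ schur A S j k = cj (schur A S k j), cj (schur A S j j) = schur A S j j
    & cj (schur A S k k) = schur A S k k].

(** The edges from B to B + i of a tiling: each one is on the right boundary or is
    one of the two left edges of a rhombus. *)
Variable edge : {set 'I_n} -> 'I_n -> Prop.
Hypothesis edge_step : forall B i, edge B i ->
  B = [set x : 'I_n | (x < i)%N] \/ exists S j k,
  [/\ (j < k)%N, j \notin S /\ k \notin S, hermitian_face S j k,
      edge S j /\ edge (j |: S) k & (i = j /\ B = k |: S) \/ (i = k /\ B = S)].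
Hypothesis edge_left : forall i, edge [set x : 'I_n | (i < x)%N] i.
Hypothesis diag_real : forall i,
  cj (schur A [set x : 'I_n | (x < i)%N] i i) = schur A [set x : 'I_n | (x < i)%N] i i.

Let A' := adjoint cj A.
Let low i := [set x : 'I_n | (x < i)%N].
Let high i := [set x : 'I_n | (i < x)%N].

Let A'_nz S : minor A' S S != 0.
Proof. by rewrite minor_adjoint fmorph_eq0. Qed.

Let lowN i : i \notin low i. Proof. by rewrite inE ltnn. Qed.
Let highN i : i \notin high i. Proof. by rewrite inE ltnn. Qed.

Implicit Types (X : 'M[K]_n) (s : 'I_n -> {set 'I_n}).

Let F (s : 'I_n -> {set 'I_n}) X : 'M[K]_n :=
  \matrix_(i, j) pivot X (s j) j i 0.

Let FE s X j : pivot X (s j) j = F s X *m delta_mx j 0.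
Proof. by rewrite -colE; apply/colP => i; rewrite [RHS]mxE [RHS]mxE. Qed.

Let F0 s X i j : i != j -> i \notin s j -> F s X i j = 0.
Proof. by move=> ij iS; rewrite mxE pivot_out // in_setU1 negb_or ij. Qed.

Let F1 s X j : j \notin s j -> F s X j j = 1.
Proof. by move=> jS; rewrite mxE pivot_diag. Qed.

Let unitF X : F low X \in unitmx.
Proof.
rewrite unitmxE -det_tr det_trig; last first.
  apply/is_trig_mxP => i j ij; rewrite mxE F0 ?inE -?leqNgt 1?ltnW //.
  by rewrite -val_eqE /= (gtn_eqF ij).
by rewrite big1 ?unitr1 // => i _; rewrite mxE F1.
Qed.

(** The map that sends the pivot vectors of A to those of its adjoint, on the
    edges of the right boundary. *)
Let M : 'M[K]_n := F low A' *m invmx (F low A).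

(** The pivot vectors of A and of its adjoint satisfy the same recursion across
    Hermitian faces, so M carries this property from the right to the left. *)
Let M_edge B i : edge B i -> M *m pivot A B i = pivot A' B i.
Proof.
move: {2}(sweep_rank B i).+1 (ltnSn (sweep_rank B i)) => N.
elim: N B i => // N IH B i; rewrite ltnS => BN /edge_step[->|].
  by rewrite -/(low i) !FE mulmxA mulmxKV.
move=> [S [j [k [jk [jS kS] [hjk hj hk] [e1 e2] iB]]]].
have [r1 r2 r3 r4] := sweep_rank_face jk jS kS.
have nkj : k != j by rewrite -val_eqE /= (gtn_eqF jk).
have njk : j != k by rewrite eq_sym.
have ratio u v : u \notin S -> v \notin S -> schur A S u v = cj (schur A S v u) ->
    cj (schur A S u u) = schur A S u u ->
    schur A' S u v / schur A' S u u = schur A S u v / schur A S u u.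
  by move=> uS vS huv hu; rewrite !(schur_adjoint cjK) // hu huv.
have hkj : schur A S k j = cj (schur A S j k) by rewrite hjk cjK.
have stepA u v := @pivot_step _ _ A S u v (A_nz S) (A_nz (v |: S)).
have stepA' u v := @pivot_step _ _ A' S u v (A'_nz S) (A'_nz (v |: S)).
have lt1 : (sweep_rank S j < N)%N by case: iB BN => [[-> ->]|[-> ->]]; apply: leq_trans.
have lt2 : (sweep_rank (j |: S) k < N)%N
  by case: iB BN => [[-> ->]|[-> ->]]; apply: leq_trans.
have Mj := IH _ _ lt1 e1; have Mjk := IH _ _ lt2 e2.
have Mk : M *m pivot A S k = pivot A' S k.
  move: Mjk; rewrite stepA // stepA' // ratio // mulmxBr -scalemxAr Mj.
  by move/(congr1 (fun v => v + (schur A S j k / schur A S j j) *: pivot A' S j)); rewrite !subrK.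
case: iB => [[-> ->]|[-> ->]] //.
by rewrite stepA // stepA' // ratio // mulmxBr -scalemxAr Mj Mk.
Qed.

(** The vectors on the right boundary make M upper unitriangular, those on the
    left boundary make it lower unitriangular. *)
Let M_id : M = 1%:M.
Proof.
have Mlow : M *m F low A = F low A' by rewrite mulmxKV.
have Mhigh : M *m F high A = F high A'.
  apply/matrixP => i j.
  have := congr1 (fun v : 'cV_n => v i 0) (M_edge (edge_left j)).
  by rewrite -/(high j) !FE mulmxA -!colE !mxE.
apply/matrixP => i j; rewrite [RHS]mxE; have [ji|ij] := leqP j i.
  apply: (unitriangular_id (rk := @nat_of_ord n) _ _ _ _ Mlow) => // x; try exact: F1.
    by move=> y xy yx; apply: F0; rewrite // inE -leqNgt.
  by move=> y xy yx; apply: F0; rewrite // inE -leqNgt.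
apply: (unitriangular_id (rk := fun i : 'I_n => (n - i)%N) _ _ _ _ Mhigh) => //;
  try (by move=> x; exact: F1); last lia.
  move=> x y xy yx; apply: F0; rewrite // inE -leqNgt.
  by have := ltn_ord x; have := ltn_ord y; lia.
move=> x y xy yx; apply: F0; rewrite // inE -leqNgt.
by have := ltn_ord x; have := ltn_ord y; lia.
Qed.

Let pivot_low i : pivot A' (low i) i = pivot A (low i) i.
Proof. by rewrite !FE -[F low A](mul1mx) -M_id mulmxKV. Qed.

(** For the matrix U of the common pivot vectors on the right boundary, A U and
    A' U are lower triangular with the same diagonal, hence U^* (A - A') U is
    strictly lower triangular; being skew-Hermitian, it vanishes. *)
Lemma hermitian_of_sweep : adjoint cj A = A.
Proof.
pose D := A - A'; pose U := F low A.
have DU i j : (i <= j)%N -> (D *m U) i j = 0.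
  move=> ij; have -> : (D *m U) i j = schur A (low j) i j - schur A' (low j) i j.
    rewrite /schur pivot_low !FE -/U !mulmxA -!colE mulmxBl !mxE.
    by congr (_ - _); apply: eq_bigr => x _; rewrite !mxE.
  have [->|nij] := eqVneq i j.
    by rewrite (schur_adjoint cjK) // diag_real subrr.
  have il : i \in low j by rewrite inE ltn_neqAle ij andbT.
  by rewrite !schur_in // subrr.
pose Q := adjoint cj U *m (D *m U).
have Qlow i j : (i <= j)%N -> Q i j = 0.
  move=> ij; rewrite mxE big1 // => x _; rewrite [adjoint _ _ _ _]mxE [map_mx _ _ _ _]mxE.
  have [xi|ix] := leqP x i; first by rewrite DU ?mulr0 // (leq_trans xi).
  rewrite F0 ?rmorph0 ?mul0r // ?inE -?leqNgt 1?ltnW //.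
  by rewrite -val_eqE /= (gtn_eqF ix).
have adjM (X Y : 'M[K]_n) : adjoint cj (X *m Y) = adjoint cj Y *m adjoint cj X.
  by rewrite /adjoint map_mxM trmx_mul.
have adjD : adjoint cj D = - D.
  by apply/matrixP => i j; rewrite !mxE rmorphB /= cjK opprB.
have adjQ : adjoint cj Q = - Q.
  by rewrite /Q !adjM adjD (adjointK cjK) mulmxN mulNmx mulmxA.
have Q0 : Q = 0.
  apply/matrixP => i j; rewrite [RHS]mxE; have [/Qlow//|ji] := leqP i j.
  have := congr1 (fun X : 'M_n => X i j) adjQ.
  rewrite [adjoint _ _ _ _]mxE [map_mx _ _ _ _]mxE (Qlow j i (ltnW ji)) rmorph0.
  by rewrite mxE => /eqP; rewrite eq_sym oppr_eq0 => /eqP.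
have uU : U \in unitmx by exact: unitF.
have uU' : adjoint cj U \in unitmx by rewrite unitmx_tr map_unitmx.
have /eqP : D = 0.
  by rewrite -[D](mulmxK uU) -[D *m U](mulKmx uU') -/Q Q0 mulmx0 mul0mx.
by rewrite subr_eq0 => /eqP.
Qed.

End Converse.

(** * The condition on a face *)

Section FaceCondition.
Variables (K : numFieldType) (cj : {rmorphism K -> K}) (cjK : involutive cj).
Hypothesis normE : forall x : K, `|x| ^+ 2 = x * cj x.
Variables (n : nat) (A : 'M[K]_n).
Hypothesis genA : generic A.
Implicit Types (S : {set 'I_n}) (i j k : 'I_n).

Lemma odd_index_swap S j k : j != k -> odd_index S k j = ~~ odd_index S j k.
Proof.
rewrite -val_eqE /= /odd_index -signr_odd; set a : nat := j; set b : nat := k => jk.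
by case: (odd _); rewrite ?expr0 ?expr1; lia.
Qed.

Lemma odd_minor_neq0 S j k : j != k -> j \notin S -> k \notin S ->
  odd_minor A S j k != 0.
Proof.
move=> jk jS kS; rewrite /odd_minor; case: ifPn => [o|]; first by case: genA => _; apply.
by rewrite -odd_index_swap // => o; case: genA => _; apply; rewrite // eq_sym.
Qed.

(** By the Desnanot-Jacobi identity the right-hand side is the product of the two
    almost-principal minors, and the odd one can be cancelled. *)
Lemma face_conditionP S j k : j != k -> j \notin S -> k \notin S ->
  cj (minor A S S) = minor A S S ->
  `|odd_minor A S j k| ^+ 2 =
     minor A (j |: S) (j |: S) * minor A (k |: S) (k |: S) -
     minor A S S * minor A (k |: (j |: S)) (k |: (j |: S)) <->
  schur A S j k = cj (schur A S k j).
Proof.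
move=> jk jS kS rS; have [mnz _] := genA.
rewrite -jacobi // normE; have := odd_minor_neq0 jk jS kS.
have mS := mnz S; rewrite /odd_minor !minor_schur // [insertion_sign S k (+) _]addbC.
have sgn (b : bool) x y : (-1) ^+ b * x * ((-1) ^+ b * y) = x * y :> K.
  by case: b; rewrite ?expr0 ?expr1; ring.
case: ifP => _; rewrite mulf_eq0 signr_eq0 mulf_eq0 (negPf mS) /= => Gnz.
  rewrite !rmorphM rmorph_sign /= rS !sgn.
  split=> [e|->]; last by rewrite cjK; ring.
  have /(mulfI mS)/(mulfI Gnz)/(mulfI mS) <- : minor A S S * (schur A S j k *
    (minor A S S * cj (schur A S j k))) = minor A S S * (schur A S j k *
    (minor A S S * schur A S k j)) by rewrite !mulrA in e *.
  by rewrite cjK.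
rewrite !rmorphM rmorph_sign /= rS !sgn.
split=> [e|->]; last by ring.
have /(mulfI mS)/(mulfI Gnz)/(mulfI mS) -> // : minor A S S * (schur A S k j *
    (minor A S S * schur A S j k)) = minor A S S * (schur A S k j *
    (minor A S S * cj (schur A S k j))).
by rewrite !mulrA in e *; rewrite e; ring.
Qed.

End FaceCondition.

From mathcomp Require Import all_classical all_reals all_analysis complex.
Import numFieldNormedType.Exports.
Local Open Scope classical_set_scope.
Local Open Scope ring_scope.

(** * Parallelograms in the plane *)

Section Plane.
Variable R : realType.
Notation plane := 'rV[R]_2.
Implicit Types (p u w x y z : plane) (a b c e : R).

Definition cross u w : R := u 0 0 * w 0 1 - u 0 1 * w 0 0.
Definition dot u w : R := u 0 0 * w 0 0 + u 0 1 * w 0 1.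

Lemma plane_eqP x y : x 0 0 = y 0 0 -> x 0 1 = y 0 1 -> x = y.
Proof.
move=> h0 h1; apply/rowP => c; case: c => [[|[|//]] hc].
  by rewrite (_ : Ordinal hc = 0) //; apply: val_inj.
by rewrite (_ : Ordinal hc = 1) //; apply: val_inj.
Qed.

Lemma crossC u w : cross u w = - cross w u.
Proof. by rewrite /cross; ring. Qed.

Lemma crossuu u : cross u u = 0.
Proof. by rewrite /cross; ring. Qed.

Fact cross_is_linear u : linear (cross u).
Proof. by move=> a x y; rewrite /cross !mxE -[_ *: _]/(_ * _); ring. Qed.
HB.instance Definition _ u :=
  GRing.isLinear.Build R plane R _ (cross u) (cross_is_linear u).

Fact dot_is_linear u : linear (dot u).
Proof. by move=> a x y; rewrite /dot !mxE -[_ *: _]/(_ * _); ring. Qed.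
HB.instance Definition _ u :=
  GRing.isLinear.Build R plane R _ (dot u) (dot_is_linear u).

Lemma crossDr u x y : cross u (x + y) = cross u x + cross u y.
Proof. exact: linearD. Qed.
Lemma crossBr u x y : cross u (x - y) = cross u x - cross u y.
Proof. exact: linearB. Qed.
Lemma crossZr u a x : cross u (a *: x) = a * cross u x.
Proof. exact: linearZ. Qed.
Lemma dotDr u x y : dot u (x + y) = dot u x + dot u y.
Proof. exact: linearD. Qed.
Lemma dotBr u x y : dot u (x - y) = dot u x - dot u y.
Proof. exact: linearB. Qed.
Lemma dotZr u a x : dot u (a *: x) = a * dot u x.
Proof. exact: linearZ. Qed.

Lemma cross_decomp u w z : cross u w *: z = cross z w *: u + cross u z *: w.
Proof. by apply: plane_eqP; rewrite /cross !mxE; ring. Qed.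

Lemma continuous_cross u p : continuous (fun z : plane => cross u (z - p)).
Proof.
have -> : (fun z : plane => cross u (z - p)) =
          (fun z : plane => u 0 0 * (z 0 1 - p 0 1) - u 0 1 * (z 0 0 - p 0 0)).
  by apply/funext => z; rewrite /cross !mxE.
have c (i : 'I_2) k : continuous (fun z : plane => k * (z 0 i - p 0 i)).
  have c1 : continuous (fun z : plane => z 0 i - p 0 i).
    by move=> z; apply: continuousB; [exact: coord_continuous | exact: cst_continuous].
  by move=> z; exact: (cvgMl_tmp (c1 z)).
by move=> z; exact: (cvgB (c 1 (u 0 0) z) (c 0 (u 0 1) z)).
Qed.

Definition para p u w : set plane :=
  [set x | exists a b, [/\ 0 <= a <= 1, 0 <= b <= 1 & x = p + a *: u + b *: w]].
Definition open_para p u w : set plane :=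
  [set x | exists a b, [/\ 0 < a < 1, 0 < b < 1 & x = p + a *: u + b *: w]].

Lemma para_coords p u w x : cross u w != 0 ->
  x = p + (cross (x - p) w / cross u w) *: u + (cross u (x - p) / cross u w) *: w.
Proof.
move=> D; apply: (scalerI D); rewrite !scalerDr !scalerA ![_ * (_ / _)]mulrC !divfK //.
by rewrite -addrA -cross_decomp -scalerDr addrC subrK.
Qed.

Lemma coords_para p u w a b : cross u w != 0 ->
  let x := p + a *: u + b *: w in
  cross (x - p) w / cross u w = a /\ cross u (x - p) / cross u w = b.
Proof.
move=> D x; have -> : x - p = a *: u + b *: w by rewrite /x addrAC [p + _ - p]addrAC subrr add0r.
rewrite [cross (_ + _) _]crossC !crossDr !crossZr !crossuu !mulr0 addr0 add0r.
by rewrite [cross w u]crossC mulrN opprK !mulfK.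
Qed.

Lemma open_para_interior p u w : cross u w != 0 -> open_para p u w `<=` (para p u w)°.
Proof.
move=> D x [a [b [a01 b01 xE]]].
have [xa xb] := coords_para p a b D; rewrite -xE in xa xb.
have ca : continuous (fun z : plane => cross (z - p) w / cross u w).
  have -> : (fun z : plane => cross (z - p) w / cross u w) =
            (fun z : plane => cross w (z - p) * - (cross u w)^-1).
    by apply/funext => z; rewrite crossC mulNr mulrN.
  by move=> z; exact: (cvgMr_tmp (@continuous_cross w p z)).
have cb : continuous (fun z : plane => cross u (z - p) / cross u w).
  by move=> z; exact: (cvgMr_tmp (@continuous_cross u p z)).
have nI (r : R) : 0 < r < 1 -> nbhs r [set y : R | 0 < y < 1].
  move=> r01; have : r \in `]0, 1[ by rewrite in_itv.
  by move/near_in_itvoo; apply: filterS => y /=; rewrite in_itv.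
have na : nbhs x [set z | 0 < cross (z - p) w / cross u w < 1].
  have h : 0 < cross (x - p) w / cross u w < 1 by rewrite xa.
  exact: (@ca x _ (nI _ h)).
have nb : nbhs x [set z | 0 < cross u (z - p) / cross u w < 1].
  have h : 0 < cross u (x - p) / cross u w < 1 by rewrite xb.
  exact: (@cb x _ (nI _ h)).
apply: filterS2 na nb => z /= /andP[a0 a1] /andP[b0 b1].
exists (cross (z - p) w / cross u w), (cross u (z - p) / cross u w).
by rewrite !ltW //; split=> //; exact: para_coords.
Qed.

Lemma interior_line (A : set plane) x w : A° x ->
  exists2 e, 0 < e & A (x + e *: w) /\ A (x - e *: w).
Proof.
move=> Ax.
have cl : (fun e : R => x + e *: w) @ (0 : R) --> x.
  have h := cvgD (@cst_continuous _ _ x (0 : R))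
    (@cvgZr_tmp _ _ _ _ _ _ _ w (@cvg_id _ (nbhs (0 : R)))).
  rewrite scale0r addr0 in h; exact: h.
have n1 : \forall e \near (0 : R), A (x + e *: w) by exact: cl.
have n2 : \forall e \near (0 : R), A (x - e *: w).
  by rewrite -oppr0 nearN; apply: filterS n1 => e; rewrite scaleNr opprK.
have [e /= e0 he] : \forall e \near (0 : R), A (x + e *: w) /\ A (x - e *: w).
  by apply: filterS2 n1 n2.
exists (e / 2); first by rewrite divr_gt0.
by apply: he; rewrite /= sub0r normrN gtr0_norm ?divr_gt0 // ltr_pdivrMr // ltr_pMr // ltr1n.
Qed.
End Plane.

(** * Half open parallelograms *)

Section HalfOpen.
Variable R : realType.
Notation plane := 'rV[R]_2.
Implicit Types (p u v w x y z : plane) (a b c e : R).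

Lemma paraP p u w x : 0 < cross u w ->
  para p u w x <-> (0 <= cross (x - p) w <= cross u w) /\ (0 <= cross u (x - p) <= cross u w).
Proof.
move=> D; have D0 : cross u w != 0 by rewrite gt_eqF.
split=> [[a [b [/andP[a0 a1] /andP[b0 b1] xE]]]|[/andP[a0 a1] /andP[b0 b1]]].
  have [xa xb] := coords_para p a b D0; rewrite -xE in xa xb.
  have -> : cross (x - p) w = a * cross u w by rewrite -xa divfK.
  have -> : cross u (x - p) = b * cross u w by rewrite -xb divfK.
  by split; rewrite mulr_ge0 ?(ltW D) //= ler_piMl // ltW.
exists (cross (x - p) w / cross u w), (cross u (x - p) / cross u w).
split; last exact: para_coords.
  by rewrite divr_ge0 ?(ltW D) //= ler_pdivrMr // mul1r.
by rewrite divr_ge0 ?(ltW D) //= ler_pdivrMr // mul1r.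
Qed.

Lemma open_paraP p u w x : 0 < cross u w ->
  open_para p u w x <-> (0 < cross (x - p) w < cross u w) /\ (0 < cross u (x - p) < cross u w).
Proof.
move=> D; have D0 : cross u w != 0 by rewrite gt_eqF.
split=> [[a [b [/andP[a0 a1] /andP[b0 b1] xE]]]|[/andP[a0 a1] /andP[b0 b1]]].
  have [xa xb] := coords_para p a b D0; rewrite -xE in xa xb.
  have -> : cross (x - p) w = a * cross u w by rewrite -xa divfK.
  have -> : cross u (x - p) = b * cross u w by rewrite -xb divfK.
  by split; rewrite mulr_gt0 //= gtr_pMl.
exists (cross (x - p) w / cross u w), (cross u (x - p) / cross u w).
split; last exact: para_coords.
  by rewrite divr_gt0 //= ltr_pdivrMr // mul1r.
by rewrite divr_gt0 //= ltr_pdivrMr // mul1r.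
Qed.

(** The sign of a + b e + c e^2 for infinitesimal positive e. *)
Definition lex_gt0 a b c : bool :=
  (0 < a) || (a == 0) && ((0 < b) || (b == 0) && (0 < c)).

Lemma lex_gt0_near a b c : lex_gt0 a b c ->
  \forall e \near 0^'+, 0 < a + b * e + c * e ^+ 2.
Proof.
have M1 (y : R) : 0 < `|y| + 1 by rewrite ltr_pwDr.
have N (y : R) : 0 <= y + `|y| by have := lerNnormlW (lexx `|y|); lra.
case/orP => [a0|/andP[/eqP-> /orP[b0|/andP[/eqP-> c0]]]].
- have M : 0 < `|b| + `|c| + 1 by rewrite ltr_pwDr // addr_ge0.
  have q : 0 < a / (`|b| + `|c| + 1) by rewrite divr_gt0.
  apply: filterS3 (nbhs_right_gt 0) (nbhs_right_lt (@ltr01 R)) (nbhs_right_lt q) => e e0 e1.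
  rewrite ltr_pdivlMr // => ea.
  have hb : 0 <= (b + `|b|) * e by rewrite mulr_ge0 ?(ltW e0).
  have hc : 0 <= (c + `|c|) * e ^+ 2.
    by rewrite mulr_ge0 ?sqr_ge0.
  have hc' : 0 <= `|c| * (e * (1 - e)).
    by apply: mulr_ge0 => //; apply: mulr_ge0; rewrite ?subr_ge0 ltW.
  by move: hb hc hc' ea; rewrite !mulrDl !mulrDr !expr2; lra.
- have q : 0 < b / (`|c| + 1) by rewrite divr_gt0.
  apply: filterS2 (nbhs_right_gt 0) (nbhs_right_lt q) => e e0.
  rewrite ltr_pdivlMr // add0r => eb.
  have hc : 0 <= (c + `|c|) * e.
    by rewrite mulr_ge0 ?(ltW e0).
  by rewrite expr2 mulrA -mulrDl mulr_gt0 //; move: hc eb; rewrite !mulrDl !mulrDr; lra.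
- apply: filterS (nbhs_right_gt 0) => e e0.
  by rewrite mul0r !add0r mulr_gt0 // exprn_gt0.
Qed.

Lemma lex_gt0N a b c : (b != 0) || (c != 0) -> ~~ lex_gt0 a b c -> lex_gt0 (- a) (- b) (- c).
Proof. by rewrite /lex_gt0 !oppr_gt0 !oppr_eq0; case: ltgtP; case: (ltgtP b); case: (ltgtP c). Qed.

(** Membership in the half open parallelogram consisting of the points x for
    which the curve x + e v + e^2 v' is in the interior for small e > 0. The
    second order term only matters if v is parallel to an edge. *)
Definition half_para p u w v v' x : bool :=
  let D := cross u w in
  [&& lex_gt0 (cross (x - p) w) (cross v w) (cross v' w),
      lex_gt0 (D - cross (x - p) w) (- cross v w) (- cross v' w),
      lex_gt0 (cross u (x - p)) (cross u v) (cross u v') &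
      lex_gt0 (D - cross u (x - p)) (- cross u v) (- cross u v')].

Lemma cross_curve u v v' x p e :
  cross u (x + e *: v + e ^+ 2 *: v' - p) =
  cross u (x - p) + cross u v * e + cross u v' * e ^+ 2.
Proof. by rewrite !crossBr !crossDr !crossZr; ring. Qed.

Lemma crossl_curve w v v' x p e :
  cross (x + e *: v + e ^+ 2 *: v' - p) w =
  cross (x - p) w + cross v w * e + cross v' w * e ^+ 2.
Proof. by rewrite ![cross _ w]crossC cross_curve; ring. Qed.

Lemma half_para_near p u w v v' x : 0 < cross u w -> half_para p u w v v' x ->
  \forall e \near 0^'+, open_para p u w (x + e *: v + e ^+ 2 *: v').
Proof.
move=> D /and4P[/lex_gt0_near h1 /lex_gt0_near h2 /lex_gt0_near h3 /lex_gt0_near h4].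
near=> e; apply/open_paraP => //; rewrite crossl_curve cross_curve; split.
  apply/andP; split; first by near: e.
  rewrite -subr_gt0; have -> : forall a b c d : R, a - (b + c * e + d * e ^+ 2) =
    a - b + - c * e + - d * e ^+ 2 by move=> *; ring.
  by near: e.
apply/andP; split; first by near: e.
rewrite -subr_gt0; have -> : forall a b c d : R, a - (b + c * e + d * e ^+ 2) =
  a - b + - c * e + - d * e ^+ 2 by move=> *; ring.
by near: e.
Unshelve. all: by end_near.
Qed.

Lemma not_half_para_near p u w v v' x : 0 < cross u w ->
  (cross v w != 0) || (cross v' w != 0) -> (cross u v != 0) || (cross u v' != 0) ->
  ~~ half_para p u w v v' x ->
  \forall e \near 0^'+, ~ para p u w (x + e *: v + e ^+ 2 *: v').
Proof.
move=> D t1 t2; rewrite !negb_and.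
have N (b c : R) : (b != 0) || (c != 0) -> (- b != 0) || (- c != 0) by rewrite !oppr_eq0.
pose P e := para p u w (x + e *: v + e ^+ 2 *: v').
have key a b c : (b != 0) || (c != 0) -> ~~ lex_gt0 a b c ->
    (forall e, P e -> 0 <= a + b * e + c * e ^+ 2) -> \forall e \near 0^'+, ~ P e.
  move=> bc /(lex_gt0N bc)/lex_gt0_near h Pa; apply: filterS h => e he /Pa.
  by move: he; rewrite !mulNr -!opprD oppr_gt0 ltNge => /negP.
have bounds e : P e ->
    [/\ 0 <= cross (x - p) w + cross v w * e + cross v' w * e ^+ 2 <= cross u w &
        0 <= cross u (x - p) + cross u v * e + cross u v' * e ^+ 2 <= cross u w].
  by move=> /(paraP _ _ D); rewrite crossl_curve cross_curve => -[].
case/or4P => h.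
- by apply: key t1 h _ => e /bounds[/andP[]].
- by apply: key (N _ _ t1) h _ => e /bounds[/andP[_ h1] _]; lra.
- by apply: key t2 h _ => e /bounds[_ /andP[]].
- by apply: key (N _ _ t2) h _ => e /bounds[_ /andP[_ h1]]; lra.
Qed.

End HalfOpen.

(** * The directions of the edges *)

Section Directions.
Variables (R : realType) (n : nat).
Notation plane := 'rV[R]_2.
Implicit Types (i j k l : 'I_n) (x y z : plane).
Notation e j := (dir R j).

Lemma cross_dir_gt0 j k : (j < k)%N -> 0 < cross (e j) (e k).
Proof.
move=> jk; have n0 : (0 : R) < n%:R by rewrite ltr0n (leq_ltn_trans _ (ltn_ord k)).
have -> : cross (e j) (e k) = sin (pi * ((k%:R - j%:R) / n%:R)).
  by rewrite /cross !mxE /= mulrBl mulrBr !mulrA sinB; ring.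
have kj : (0 : R) < k%:R - j%:R by rewrite subr_gt0 ltr_nat.
have nk : k%:R - j%:R < n%:R :> R.
  by rewrite ltrBlDr (@lt_le_trans _ _ n%:R) ?ltr_nat // lerDl.
apply: sin_gt0_pi; rewrite mulr_gt0 ?divr_gt0 ?pi_gt0 //=.
by rewrite gtr_pMr ?pi_gt0 // ltr_pdivrMr // mul1r.
Qed.

Lemma cross_dir_neq0 j k : j != k -> cross (e j) (e k) != 0.
Proof.
rewrite -val_eqE /= neq_ltn => /orP[] /cross_dir_gt0 h; last rewrite crossC oppr_eq0.
  by rewrite gt_eqF.
by rewrite gt_eqF.
Qed.

Lemma dot_dir i : dot (e i) (e i) = 1.
Proof. by rewrite /dot !mxE /= -!expr2 cos2Dsin2. Qed.

Definition perp (u : plane) : plane := \row_(c < 2) (if c == 0 then - u 0 1 else u 0 0).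

Lemma cross_perp u z : cross (perp u) z = - dot u z.
Proof. by rewrite /cross /dot !mxE /=; ring. Qed.

Lemma cross_perp_dir i : cross (e i) (perp (e i)) = 1.
Proof. by rewrite crossC cross_perp dot_dir opprK. Qed.

(** As e_i has length 1, these are orthonormal coordinates. *)
Lemma eq_dot_cross i x y : dot (e i) x = dot (e i) y -> cross (e i) x = cross (e i) y -> x = y.
Proof.
have h z : z = dot (e i) z *: e i + cross (e i) z *: perp (e i).
  have := cross_decomp (e i) (perp (e i)) z; rewrite cross_perp_dir scale1r => {1}->.
  by rewrite [cross z _]crossC cross_perp opprK.
by move=> d c; rewrite (h x) (h y) d c.
Qed.

End Directions.

(** * Counting half open rhombi *)

Section Tilings.
Variables (R : realType) (n : nat).
Notation plane := 'rV[R]_2.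
Notation e j := (dir R j).
Implicit Types (T : tiling R n) (i j k l : 'I_n) (f g : face n) (x y z : plane).

Lemma face_lt f : (fst_dir f < snd_dir f)%N.
Proof. by case: f. Qed.

Lemma face_cross f : 0 < cross (e (fst_dir f)) (e (snd_dir f)).
Proof. exact/cross_dir_gt0/face_lt. Qed.

Definition in_face i f := (i == fst_dir f) || (i == snd_dir f).

Definition open_rhombus T f := open_para (pos T f) (e (fst_dir f)) (e (snd_dir f)).

Lemma rhombus_polygon T f x : rhombus f (pos T f) x -> @polygon R n x.
Proof. by move=> h; rewrite -(tiling_cover T); exists f. Qed.

Lemma open_rhombus_sub T f x : open_rhombus T f x -> rhombus f (pos T f) x.
Proof. by move=> [a [b [/andP[a0 a1] /andP[b0 b1] ->]]]; exists a, b; rewrite !ltW. Qed.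

Lemma half_of_open (p u w v x : plane) :
  open_para p u w x -> 0 < cross u w -> half_para p u w v 0 x.
Proof.
move=> h D; move/(open_paraP _ _ D): h => -[/andP[h1 h2] /andP[h3 h4]].
by rewrite /half_para /lex_gt0 h1 h3 !subr_gt0 h2 h4.
Qed.

(** A point of the closed rhombus g enters the interior of g when it is moved
    towards the centre c of g, and stays in the open rhombus f if it is moved by
    a small amount. *)
Lemma open_rhombus_meet T f g x : open_rhombus T f x -> rhombus g (pos T g) x -> f = g.
Proof.
move=> fx gx; apply/eqP/negPn/negP => fg.
have Df := face_cross f; have Dg := face_cross g.
set p := pos T g in gx; set u := e (fst_dir g) in gx; set w := e (snd_dir g) in gx.
pose c := p + 2^-1 *: u + 2^-1 *: w.
have nf := half_para_near Df (half_of_open (c - x) fx Df).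
have ng : \forall s \near 0^'+, open_para p u w (x + s *: (c - x) + s ^+ 2 *: 0).
  case: gx => a [b [/andP[a0 a1] /andP[b0 b1] xE]].
  apply: filterS2 (nbhs_right_gt 0) (nbhs_right_lt (@ltr01 R)) => s s0 s1.
  exists (a + s * (2^-1 - a)), (b + s * (2^-1 - b)); split; [nra | nra |].
  by rewrite /c xE; apply: plane_eqP; rewrite !mxE; ring.
have [s [/(open_para_interior (lt0r_neq0 Df)) sf /(open_para_interior (lt0r_neq0 Dg)) sg]] :=
  filter_ex (filterI nf ng).
by have : set0 (x + s *: (c - x) + s ^+ 2 *: 0) by rewrite -(tiling_disjoint T fg).
Qed.

(** Near x the curve is in the interior of at most one rhombus, and it is in the
    interior of one if and only if it is in the polygon, which is the same for
    all tilings. *)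
Lemma half_open_count T T' v v' x :
  (forall j : 'I_n, (cross v (e j) != 0) || (cross v' (e j) != 0)) ->
  (\sum_f half_para (pos T f) (e (fst_dir f)) (e (snd_dir f)) v v' x =
   \sum_f half_para (pos T' f) (e (fst_dir f)) (e (snd_dir f)) v v' x)%N.
Proof.
move=> tr.
have tr' j : (cross (e j) v != 0) || (cross (e j) v' != 0).
  by rewrite ![cross (e j) _]crossC !oppr_eq0.
pose H T0 f := half_para (pos T0 f) (e (fst_dir f)) (e (snd_dir f)) v v' x.
have uniqH T0 f g : H T0 f -> H T0 g -> f = g.
  move=> /(half_para_near (face_cross f)) nf /(half_para_near (face_cross g)) ng.
  have [s [sf sg]] := filter_ex (filterI nf ng).
  exact: open_rhombus_meet sf (open_rhombus_sub sg).
have exH T1 T2 f : H T1 f -> exists g, H T2 g.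
  move=> /(half_para_near (face_cross f)) nf; apply: contrapT => /forallNP no.
  have ng : \forall s \near 0^'+, forall g, ~ rhombus g (pos T2 g) (x + s *: v + s ^+ 2 *: v').
    apply: filter_forall => g.
    by apply: not_half_para_near; [exact: face_cross | exact: tr | exact: tr' | exact/negP/no].
  have [s [sf sg]] := filter_ex (filterI nf ng).
  have : @polygon R n (x + s *: v + s ^+ 2 *: v').
    exact: rhombus_polygon (open_rhombus_sub sf).
  by rewrite -(tiling_cover T2) => -[g _ /sg].
have sumH T0 : (\sum_f H T0 f = [exists f, H T0 f])%N.
  case: existsP => [[f Hf]|no]; last first.
    by rewrite big1 // => f _; case Hf: (H T0 f) => //; case: no; exists f.
  rewrite (bigD1 f) //= Hf big1 // => g gf; case Hg: (H T0 g) => //.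
  by rewrite (uniqH _ _ _ Hg Hf) eqxx in gf.
rewrite -!/(H _ _) !sumH; congr nat_of_bool.
by apply/existsP/existsP => -[f /exH]; apply.
Qed.

End Tilings.

(** * Strips of rhombi *)

Section Strips.
Variables (R : realType) (n : nat).
Notation plane := 'rV[R]_2.
Notation e j := (dir R j).
Implicit Types (T : tiling R n) (i j k l : 'I_n) (f g : face n) (x y z : plane).

(** The rhombi with an edge e_i form a strip; crossing it from the right
    boundary of the polygon to the left one, each rhombus f is entered through
    the edge [entry, entry + e_i] and left through [exit, exit + e_i]. *)
Definition step i f : plane := if i == fst_dir f then e (snd_dir f) else - e (fst_dir f).
Definition entry T i f : plane := if i == fst_dir f then pos T f else pos T f + e (fst_dir f).
Definition exit T i f : plane := entry T i f + step i f.

Lemma in_face_snd i f : in_face i f -> (i == fst_dir f) = false -> i = snd_dir f.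
Proof. by move=> /orP[->|/eqP]. Qed.

Lemma cross_step i f : in_face i f -> 0 < cross (e i) (step i f).
Proof.
rewrite /step; case: ifP => [/eqP-> _|fi fif]; first exact: face_cross.
rewrite (in_face_snd fif fi) -scaleN1r crossZr mulN1r -crossC.
exact: face_cross.
Qed.

Lemma strip_rhombusP T i f x : in_face i f ->
  rhombus f (pos T f) x <-> para (entry T i f) (e i) (step i f) x.
Proof.
rewrite /step /entry; case: ifP => [/eqP-> //|fi fif]; rewrite (in_face_snd fif fi).
split=> -[a [b [a01 b01 ->]]].
  exists b, (1 - a); rewrite b01; split=> //; first by lra.
  by apply: plane_eqP; rewrite !mxE; ring.
exists (1 - b), a; rewrite a01; split=> //; first by lra.
by apply: plane_eqP; rewrite !mxE; ring.
Qed.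

Lemma strip_half_para T i f v v' x : in_face i f ->
  half_para (pos T f) (e (fst_dir f)) (e (snd_dir f)) v v' x =
  half_para (entry T i f) (e i) (step i f) v v' x.
Proof.
rewrite /step /entry; case: ifP => [/eqP-> //|fi fif]; rewrite -(in_face_snd fif fi).
set u := e (fst_dir f); set p := pos T f; rewrite /half_para.
have -> : cross (e i) (- u) = cross u (e i) by rewrite /cross !mxE; ring.
have -> : cross (x - (p + u)) (- u) = cross u (x - p) by rewrite /cross !mxE; ring.
have -> : cross (e i) (x - (p + u)) = cross u (e i) - cross (x - p) (e i).
  by rewrite /cross !mxE; ring.
have c y : cross y (- u) = cross u y by rewrite /cross !mxE; ring.
rewrite !c ![cross (e i) _]crossC opprK opprK.
rewrite subKr.
by rewrite andbCA [RHS]andbC -!andbA; do !bool_congr.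
Qed.

Definition in_segment i y x : bool :=
  (cross (e i) (x - y) == 0) && (0 <= dot (e i) (x - y) < 1).

Lemma on_line i y x : cross (e i) (x - y) = 0 -> x - y = dot (e i) (x - y) *: e i.
Proof.
move=> c; apply: (@eq_dot_cross _ _ i); first by rewrite dotZr dot_dir mulr1.
by rewrite c crossZr crossuu mulr0.
Qed.

(** The rhombi made half open towards the left and towards the right of e_i differ
    in which one of their two edges parallel to e_i they contain. *)
Lemma strip_half_diff T i f x : in_face i f ->
  (half_para (entry T i f) (e i) (step i f) (e i) (perp (e i)) x
     + in_segment i (exit T i f) x =
   half_para (entry T i f) (e i) (step i f) (e i) (- perp (e i)) x
     + in_segment i (entry T i f) x)%N.
Proof.
move=> fif; have h0 := cross_step fif.
rewrite /half_para /in_segment /exit.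
set p := entry T i f; set w := step i f in h0 *; set h := cross (e i) w in h0 *.
set A := cross (x - p) w; set b := cross (e i) (x - p).
have -> : cross (e i) (x - (p + w)) = b - h by rewrite /b /h !crossBr !crossDr; ring.
rewrite crossuu cross_perp_dir -[- perp _]scaleN1r crossZr cross_perp_dir mulr1.
have lexh (a c : R) : lex_gt0 a h c = (0 <= a).
  by rewrite /lex_gt0 h0 andbT orbC le_eqVlt [0 == a]eq_sym.
have lexNh (a c : R) : lex_gt0 a (- h) c = (0 < a).
  by rewrite /lex_gt0 oppr_gt0 [h < 0]ltNge (ltW h0) oppr_eq0 (gt_eqF h0) andbF orbF.
have lex01 (a : R) : lex_gt0 a 0 1 = (0 <= a).
  by rewrite /lex_gt0 ltxx eqxx ltr01 /= andbT orbC le_eqVlt [0 == a]eq_sym.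
have lex0N1 (a : R) : lex_gt0 a 0 (- 1) = (0 < a).
  by rewrite /lex_gt0 ltxx eqxx oppr_gt0 ltr10 /= andbF orbF.
rewrite !oppr0 !lexh !lexNh !opprK !lex01 !lex0N1 ![0 < h - _]subr_gt0 ![0 <= h - _]subr_ge0.
have coord y : cross (e i) y = 0 -> cross y w = dot (e i) y * h.
  move=> y0; have yE : y = dot (e i) y *: e i by have := @on_line i 0 y; rewrite subr0; apply.
  by rewrite {1}yE crossC crossZr crossC mulrN opprK.
have range y : (0 <= dot (e i) y < 1) = (0 <= dot (e i) y * h < h).
  by rewrite pmulr_lge0 // gtr_pMl.
have seg0 : b = 0 -> (0 <= dot (e i) (x - p) < 1) = (0 <= A < h).
  by move=> b0; rewrite range /A coord.
have segh : b = h -> (0 <= dot (e i) (x - (p + w)) < 1) = (0 <= A < h).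
  move=> bh; have c0 : cross (e i) (x - (p + w)) = 0.
    by rewrite -[RHS](subrr h) -{1}bh /b /h !crossBr !crossDr; ring.
  have -> : A = cross (x - (p + w)) w by rewrite /A /cross !mxE; ring.
  by rewrite range coord.
rewrite subr_eq0.
have [bh|bh|bh] := ltgtP b h.
- have [b0|b0|b0] := ltgtP b 0; rewrite ?andbF ?andbT //.
  by rewrite !andTb seg0 // addnC.
- by rewrite (gt_eqF (lt_trans h0 bh)) /= !andbF.
- rewrite segh // bh (gt_eqF h0) h0 (ltW h0) /= !andbT !andbF.
  by rewrite addn0.
Qed.

(** The side of the lines spanned by the other directions on which e_i lies is not
    changed by a small perturbation. *)
Lemma half_para_off T i f x : ~~ in_face i f ->
  half_para (pos T f) (e (fst_dir f)) (e (snd_dir f)) (e i) (perp (e i)) x =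
  half_para (pos T f) (e (fst_dir f)) (e (snd_dir f)) (e i) (- perp (e i)) x.
Proof.
rewrite negb_or => /andP[/(cross_dir_neq0 R) c1 /(cross_dir_neq0 R) c2].
have lexb (a b d d' : R) : b != 0 -> lex_gt0 a b d = lex_gt0 a b d'.
  by rewrite /lex_gt0 => /negPf->.
have c1' : cross (e (fst_dir f)) (e i) != 0 by rewrite crossC oppr_eq0.
have N (b : R) : b != 0 -> - b != 0 by rewrite oppr_eq0.
by rewrite /half_para; congr [&& _, _, _ & _]; apply: lexb; do ?apply: N.
Qed.

(** Subtract the two counts of half open rhombi obtained for directions slightly
    to the left and to the right of e_i: only the edges of the strip i
    remain. *)
Lemma segment_count T T' i x :
  (\sum_(f | in_face i f) in_segment i (entry T i f) x +
   \sum_(f | in_face i f) in_segment i (exit T' i f) x =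
   \sum_(f | in_face i f) in_segment i (exit T i f) x +
   \sum_(f | in_face i f) in_segment i (entry T' i f) x)%N.
Proof.
pose H T0 v f : bool := half_para (pos T0 f) (e (fst_dir f)) (e (snd_dir f)) (e i) v x.
have tr (s : R) : s != 0 -> forall j,
    (cross (e i) (e j) != 0) || (cross (s *: perp (e i)) (e j) != 0).
  move=> s0 j; have [->|ij] := eqVneq i j; last by rewrite cross_dir_neq0.
  by rewrite orbC crossC crossZr cross_perp_dir mulr1 oppr_eq0 s0.
have cp : (\sum_f H T (perp (e i)) f = \sum_f H T' (perp (e i)) f)%N.
  by rewrite -[perp _]scale1r; apply: half_open_count; apply: tr; exact: oner_neq0.
have cm : (\sum_f H T (- perp (e i)) f = \sum_f H T' (- perp (e i)) f)%N.
  by rewrite -scaleN1r; apply: half_open_count; apply: tr; rewrite oppr_eq0 oner_neq0.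
have split T0 : (\sum_f H T0 (perp (e i)) f + \sum_(f | in_face i f) in_segment i (exit T0 i f) x =
   \sum_f H T0 (- perp (e i)) f + \sum_(f | in_face i f) in_segment i (entry T0 i f) x)%N.
  rewrite [X in (_ + X)%N]big_mkcond [X in _ = (_ + X)%N]big_mkcond -!big_split /=.
  apply: eq_bigr => f _; rewrite /H; case: ifP => [fif|/negbT fif].
    by rewrite !(strip_half_para _ _ _ _ fif); exact: strip_half_diff.
  by rewrite (half_para_off _ _ fif).
by move: (split T) (split T'); lia.
Qed.

End Strips.

Section SegmentLists.
Variables (R : realType) (n : nat) (i : 'I_n).
Notation plane := 'rV[R]_2.
Implicit Types (x y z : plane) (s P M : seq plane).
Let I x y := in_segment i y x.

Lemma exists_lowest s : s != [::] ->
  exists2 y, y \in s & forall z, z \in s -> dot (dir R i) y <= dot (dir R i) z.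
Proof.
elim: s => // a s IH _; have [->|s0] := eqVneq s [::].
  by exists a; rewrite ?mem_head // => z; rewrite inE => /eqP->.
have [y ys ymin] := IH s0.
have [ya|ay] := leP (dot (dir R i) y) (dot (dir R i) a).
  by exists y; rewrite ?inE ?ys ?orbT // => z /predU1P[->//|/ymin].
exists a; rewrite ?mem_head // => z /predU1P[->//|/ymin].
exact/le_trans/ltW.
Qed.

Lemma in_segment_self y : I y y.
Proof. by rewrite /I /in_segment subrr !linear0 eqxx lexx ltr01. Qed.

(** Let y be a lowest starting point in both lists. Only the segments that start
    at y contain y, so such segments occur in both lists, and one can be removed
    from each. *)
Lemma segments_perm P M : (forall x, count (I x) P = count (I x) M) -> perm_eq P M.
Proof.
have low P' M' y : (forall x, count (I x) P' = count (I x) M') -> y \in P' ->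
    (forall z, z \in P' ++ M' -> dot (dir R i) y <= dot (dir R i) z) -> y \in M'.
  move=> cnt yP ymin; have : has (I y) M'.
    by rewrite has_count -cnt -has_count; apply/hasP; exists y => //; exact: in_segment_self.
  move=> /hasP[z zM /andP[/eqP c /andP[d0 _]]]; suff -> : y = z by [].
  apply: (@eq_dot_cross _ _ i); last by apply/eqP; rewrite -subr_eq0 -crossBr c.
  apply: le_anti; rewrite ymin ?mem_cat ?zM ?orbT //=.
  by rewrite -subr_ge0 -dotBr.
move: {2}(size P) (leqnn (size P)) => N; elim: N P M => [|N IH] P M sP cnt.
  move: sP cnt; rewrite leqn0 size_eq0 => /eqP-> cnt.
  case: M cnt => // a M /(_ a) /=; by rewrite in_segment_self.
have [PM|PM] := eqVneq (P ++ M) [::]; first by case: P M PM {sP cnt} => [[]|].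
have [y yPM ymin] := exists_lowest PM.
have [yP yM] : y \in P /\ y \in M.
  move: yPM; rewrite mem_cat => /orP[yP|yM].
    by split=> //; apply: low yP ymin.
  split=> //; apply: low yM _ => // z; rewrite mem_cat orbC -mem_cat; exact: ymin.
rewrite (perm_trans (perm_to_rem yP)) // perm_sym.
rewrite (perm_trans (perm_to_rem yM)) // perm_cons perm_sym.
apply: IH => [|x]; first by rewrite size_rem //; case: (size P) sP.
have := cnt x; rewrite (seq.permP (perm_to_rem yP)) (seq.permP (perm_to_rem yM)) /=.
exact: addnI.
Qed.

End SegmentLists.

(** * The polygon as a zonotope, and a standard tiling *)

Section Standard.
Variables (R : realType) (n : nat).
Notation plane := 'rV[R]_2.
Notation e j := (dir R j).
Implicit Types (T : tiling R n) (i j k l : 'I_n) (f g : face n) (x y z : plane).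

Definition zonotope (m : nat) : set plane := [set x | exists c : 'I_n -> R,
  [/\ forall i, 0 <= c i <= 1, forall i, (m <= i)%N -> c i = 0 & x = \sum_i c i *: e i]].

Lemma convex_comb01 (s a b : R) : 0 <= s <= 1 -> 0 <= a <= 1 -> 0 <= b <= 1 ->
  0 <= s * a + (1 - s) * b <= 1.
Proof.
move=> /andP[s0 s1] /andP[a0 a1] /andP[b0 b1].
have s1' : 0 <= 1 - s by rewrite subr_ge0.
rewrite addr_ge0 ?mulr_ge0 //=; have := ler_wpM2l s0 a1; have := ler_wpM2l s1' b1; lra.
Qed.

Lemma zonotope_convex m : @convex_set R plane (zonotope m).
Proof.
move=> x y t; rewrite !inE => -[c [c01 c0 ->]] [d [d01 d0 ->]].
have t0 : 0 <= t%:num := ge0 t; have t1 : t%:num <= 1 := le1 t.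
exists (fun i => t%:num * c i + (1 - t%:num) * d i); split=> [i|i mi|].
- by apply: convex_comb01 => //; apply/andP.
- by rewrite c0 // d0 // !mulr0 addr0.
- rewrite /conv /= !scaler_sumr -big_split /=; apply: eq_bigr => i _.
  by rewrite [RHS]scalerDl !scalerA.
Qed.

Lemma subset_sum_zonotope (S : {set 'I_n}) : zonotope n (\sum_(j in S) e j).
Proof.
exists (fun i => (i \in S)%:R); split=> [i|i|].
- by case: (_ \in _); rewrite ?lexx ?ler01.
- by rewrite leqNgt ltn_ord.
- by rewrite big_mkcond; apply: eq_bigr => i _; case: ifP => _; rewrite ?scale1r ?scale0r.
Qed.

(** A point of the zonotope is in the hull of the subset sums: by convexity, its
    coefficients can be replaced by 0 or 1 one after the other. *)
Lemma polygonE : @polygon R n = zonotope n.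
Proof.
apply/seteqP; split=> x.
  apply: smallest_sub; first exact: zonotope_convex.
  by move=> _ [S _ <-]; exact: subset_sum_zonotope.
move=> xZ A [cA subA].
suff: forall m (c : 'I_n -> R), (forall i, 0 <= c i <= 1) ->
    (forall i, (m <= i)%N -> (c i == 0) || (c i == 1)) -> A (\sum_i c i *: e i).
  by case: xZ => c [c01 c0 ->] /(_ n c c01); apply=> i; rewrite leqNgt ltn_ord.
elim=> [|m IH] c c01 cm.
  have -> : \sum_i c i *: e i = \sum_(j in [set j | c j == 1]%SET) e j.
    rewrite [RHS]big_mkcond; apply: eq_bigr => i _; rewrite inE.
    have /orP[/eqP->|/eqP->] := cm i isT; last by rewrite eqxx scale1r.
    by rewrite eq_sym oner_eq0 scale0r.
  by apply: subA; exists [set j | c j == 1]%SET.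
have [mn|nm] := ltnP m n; last first.
  by apply: IH => // i mi; have := ltn_ord i; rewrite ltnNge (leq_trans nm mi).
pose k := Ordinal mn.
pose upd b i := if i == k then b else c i.
have upd_in b : b = 0 \/ b = 1 -> A (\sum_i upd b i *: e i).
  move=> b01; apply: IH => i; rewrite /upd; case: ifP => // ik.
    by case: b01 => ->; rewrite ?lexx ?ler01.
    by case: b01 => ->; rewrite eqxx ?orbT.
  move=> mi; apply: cm; rewrite ltn_neqAle mi andbT.
  by apply: contraFneq ik => mi'; exact/eqP/val_inj.
have /andP[ck0 ck1] := c01 k.
have := cA _ _ (Itv01 ck0 ck1) (mem_set (upd_in 1 (or_intror erefl)))
  (mem_set (upd_in 0 (or_introl erefl))).
rewrite inE; congr (A _); rewrite /conv /= !scaler_sumr -big_split /=; apply: eq_bigr => i _.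
rewrite /upd !scalerA -scalerDl; case: eqP => [->|_]; congr (_ *: _); rewrite /unstable.onem; ring.
Qed.

(** This tiling arises by attaching to the left boundary of the zonotope of e_0,
    ..., e_(k-1), for k = 2, 3, ..., a strip formed by the rhombi R_jk, j < k. *)
Definition std_pos f : plane := \sum_(l : 'I_n | (fst_dir f < l < snd_dir f)%N) e l.

Lemma std_rhombus_coeffs f (a b : R) : let c l := if (fst_dir f < l < snd_dir f)%N then 1
    else if l == fst_dir f then a else if l == snd_dir f then b else 0 in
  std_pos f + a *: e (fst_dir f) + b *: e (snd_dir f) = \sum_l c l *: e l.
Proof.
have fs := face_lt f; move=> c.
have sf : snd_dir f != fst_dir f by rewrite -val_eqE /= (gtn_eqF fs).
have cf : c (fst_dir f) = a by rewrite /c ltnn eqxx.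
have cs : c (snd_dir f) = b by rewrite /c ltnn andbF (negPf sf) eqxx.
rewrite (bigD1 (fst_dir f)) //= (bigD1 (snd_dir f)) //= cf cs -addrA addrC [RHS]addrA.
congr (_ + _).
rewrite /std_pos big_mkcond [RHS]big_mkcond /=; apply: eq_bigr => l _; rewrite /c.
case: ifP => [/andP[fl ls]|_].
  by rewrite -!val_eqE /= (gtn_eqF fl) (ltn_eqF ls) scale1r.
by do 2![case: eqP => //= _]; rewrite scale0r.
Qed.

Lemma std_rhombus_zonotope f : rhombus f (std_pos f) `<=` zonotope (snd_dir f).+1.
Proof.
move=> x [a [b [a01 b01 ->]]]; rewrite std_rhombus_coeffs.
eexists; split; last by reflexivity.
  by move=> l /=; do ![case: ifP => _ //]; rewrite ?lexx ?ler01.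
move=> l /= sl; rewrite [X in _ && X]ltnNge (ltnW sl) andbF.
by rewrite -!val_eqE /= (gtn_eqF sl) (gtn_eqF (ltn_trans (face_lt f) sl)).
Qed.

(** The maximum is attained at the coefficients 1 for the directions to the left of
    e_j and 0 for those to the right. For j < m this is the supporting line
    through the edge e_j of the left boundary. *)
Lemma zonotope_cross_le m j x : zonotope m x ->
  cross (e j) x <= \sum_(l : 'I_n | (j < l < m)%N) cross (e j) (e l).
Proof.
move=> [c [c01 c0 ->]]; rewrite linear_sum [leRHS]big_mkcond; apply: ler_sum => l _ /=.
have /andP[cl0 cl1] := c01 l; rewrite crossZr.
have [mn|lm] := leqP m l.
  by rewrite c0 // mul0r; case: ifP => // /andP[/cross_dir_gt0-/(_ R)/ltW].
have [jl|lj] := ltnP j l; first by rewrite ler_piMl // ltW // cross_dir_gt0.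
rewrite mulr_ge0_le0 // crossC oppr_le0.
by move: lj; rewrite leq_eqVlt => /orP[/eqP/val_inj->|/cross_dir_gt0-/(_ R)/ltW//]; rewrite crossuu.
Qed.

Lemma disjoint_interiors (A B : set plane) u w (c : R) : 0 < cross u w ->
  (forall x, A x -> cross u x <= c) -> (forall x, B x -> c <= cross u x) -> A° `&` B° = set0.
Proof.
move=> uw Ac Bc; apply/seteqP; split=> // x.
move=> [/(interior_line w)[s s0 [As _]] /(interior_line w)[t t0 [_ Bt]]].
have := mulr_gt0 s0 uw; have := mulr_gt0 t0 uw.
by move: (Ac _ As) (Bc _ Bt); rewrite crossDr crossBr !crossZr; lra.
Qed.

(** Rhombi of different strips are separated by the line through an edge to which
    the later one is attached, rhombi of the same strip by a line parallel to
    the common direction. *)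
Lemma std_disjoint f g : f != g ->
  (rhombus f (std_pos f))° `&` (rhombus g (std_pos g))° = set0.
Proof.
have cross_std h x : rhombus h (std_pos h) x -> exists a b : R, [/\ 0 <= a <= 1, 0 <= b <= 1 &
    forall u, cross u x = \sum_(l : 'I_n | (fst_dir h < l < snd_dir h)%N) cross u (e l)
      + a * cross u (e (fst_dir h)) + b * cross u (e (snd_dir h))].
  move=> [a [b [a01 b01 ->]]]; exists a, b; split=> // u.
  by rewrite !crossDr !crossZr linear_sum.
wlog : f g / ((snd_dir f < snd_dir g) || (snd_dir f == snd_dir g) && (fst_dir f < fst_dir g))%N.
  move=> W fg; have [s|s|s] := ltngtP (snd_dir f) (snd_dir g).
  - by apply: W => //; rewrite s.
  - by rewrite setIC; apply: W; rewrite 1?eq_sym // s.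
  have {}s : snd_dir f = snd_dir g by exact: val_inj.
  have [t|t|t] := ltngtP (fst_dir f) (fst_dir g).
  - by apply: W => //; rewrite s eqxx t orbT.
  - by rewrite setIC; apply: W; rewrite 1?eq_sym // s eqxx t orbT.
  by case/eqP: fg; apply: val_inj; rewrite [val f]surjective_pairing [val g]surjective_pairing;
    congr (_, _) => //; apply: val_inj.
move=> fg _; have gl := face_lt g.
case/orP: fg => [fg|/andP[/eqP sfg fg]].
  apply: (@disjoint_interiors _ _ (e (fst_dir g)) (e (snd_dir g))
    (\sum_(l : 'I_n | (fst_dir g < l < snd_dir g)%N) cross (e (fst_dir g)) (e l))).
  - exact: face_cross.
  - move=> x /std_rhombus_zonotope/(zonotope_cross_le (fst_dir g)) /le_trans; apply.
    rewrite big_mkcond [leRHS]big_mkcond; apply: ler_sum => l _.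
    case: ifP => [/andP[h1 h2]|_]; first by rewrite h1 (leq_trans h2).
    by case: ifP => // /andP[h1 _]; rewrite ltW // cross_dir_gt0.
  - move=> x /cross_std[a [b [/andP[a0 _] /andP[b0 _] ->]]].
    by rewrite crossuu mulr0 addr0 lerDl mulr_ge0 // ltW // face_cross.
set k := snd_dir f in sfg *; have kg l : (l < k)%N -> 0 < - cross (e k) (e l).
  by move=> lk; rewrite -crossC cross_dir_gt0.
have fk : (fst_dir f < k)%N := face_lt f.
rewrite -sfg in gl.
apply: (@disjoint_interiors _ _ (e k) (- e (fst_dir g))
    (\sum_(l : 'I_n | (fst_dir g <= l < k)%N) cross (e k) (e l))).
- by rewrite -scaleN1r crossZr mulN1r kg.
- move=> x /cross_std[a [b [/andP[a0 _] /andP[b0 _] ->]]].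
  rewrite -/k crossuu mulr0 addr0.
  have ha : a * cross (e k) (e (fst_dir f)) <= 0.
    by rewrite mulr_ge0_le0 // -oppr_ge0 ltW // kg.
  have hs : \sum_(l : 'I_n | (fst_dir f < l < k)%N) cross (e k) (e l) <=
         \sum_(l : 'I_n | (fst_dir g <= l < k)%N) cross (e k) (e l).
    rewrite big_mkcond [leRHS]big_mkcond; apply: ler_sum => l _.
    case: ifP => [/andP[h1 h2]|].
      by case: ifP => // _; rewrite -oppr_ge0 ltW // kg.
    by case: ifP => // /andP[h1 h2] /negbT; rewrite h2 andbT (leq_trans fg h1).
  lra.
- move=> x /cross_std[a [b [/andP[_ a1] /andP[b0 _] ->]]].
  rewrite -sfg crossuu mulr0 addr0 (bigD1 (fst_dir g)) /=; last by rewrite leqnn.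
  rewrite addrC; apply: lerD.
    rewrite le_eqVlt; apply/orP; left; apply/eqP; apply: eq_bigl => l.
    by rewrite andbC [in RHS]ltn_neqAle -[RHS]andbA eq_sym.
  by have := kg _ gl; nra.
Qed.

End Standard.

Section StandardTiling.
Variables (R : realType) (n : nat) (hn : (2 <= n)%N).
Notation plane := 'rV[R]_2.
Notation e j := (dir R j).
Implicit Types (T : tiling R n) (i j k l : 'I_n) (f g : face n) (x y z : plane).

Definition mk_face j k (jk : (j < k)%N) : face n := exist _ (j, k) jk.

(** For the weights |e_l x e_k| this finds the rhombus R_jk that is met by a given
    line parallel to e_k. *)
Lemma locate_weight m (w : 'I_n -> R) s : (0 < m <= n)%N ->
  (forall l : 'I_n, (l < m)%N -> 0 <= w l) ->
  0 <= s <= \sum_(l : 'I_n | (l < m)%N) w l ->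
  exists2 j : 'I_n, (j < m)%N &
    \sum_(l : 'I_n | (j < l < m)%N) w l <= s <= w j + \sum_(l : 'I_n | (j < l < m)%N) w l.
Proof.
move=> /andP[m0 mn] w0 /andP[s0 s1].
pose t (p : nat) := \sum_(l : 'I_n | (p <= l < m)%N) w l.
have tS (j : 'I_n) : (j < m)%N -> t j = w j + t j.+1.
  move=> jm; rewrite /t (bigD1 j) ?leqnn //=; congr (_ + _); apply: eq_bigl => l.
  by rewrite andbC [in RHS]ltn_neqAle -[RHS]andbA eq_sym.
have ex : exists p, t p.+1 <= s.
  by exists m; rewrite /t big1 // => l /andP[h1 h2]; have := leq_trans h1 (ltnW h2); rewrite ltnn.
have [p tp pmin] := ex_minnP ex.
have pm : (p < m)%N.
  have := pmin m.-1; rewrite prednK // => /(_ _)/leq_ltn_trans; apply; last by rewrite prednK.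
  by rewrite /t big1 // => l; rewrite leqNgt andNb.
exists (Ordinal (leq_trans pm mn)); rewrite //= tp /=.
have := tS (Ordinal (leq_trans pm mn)) pm; rewrite /= => <-.
case: p {tp} pm pmin => [|p] pm pmin; first exact: s1.
by have [//|/ltW/pmin] := leP s (t p.+1); rewrite ltnn.
Qed.

(** By induction on m. The line through x parallel to the last direction e_k meets
    the left boundary of the previous zonotope in a point y. If x lies beyond
    y, it is in a rhombus of the last strip; otherwise it lies between y and
    a point z of the previous zonotope. *)
Lemma std_cover (m : nat) x : (2 <= m <= n)%N -> zonotope n m x ->
  exists2 f : face n, (snd_dir f < m)%N & rhombus f (std_pos R f) x.
Proof.
move=> /andP[m2]; elim: m m2 => // m IH; rewrite leq_eqVlt => /predU1P[[<-]|m2] mn.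
  move=> [c [c01 c0 xE]]; pose j0 := Ordinal (ltnW mn); pose j1 := Ordinal mn.
  exists (mk_face (isT : (j0 < j1)%N)) => //.
  exists (c j0), (c j1); split=> //; rewrite /std_pos /= /fst_dir /snd_dir /=.
  rewrite big1 ?add0r => [|[[|[|l]] ll] //=].
  rewrite xE (bigD1 j0) //= (bigD1 j1) //= big1 ?addr0 // => l /andP[l0 l1].
  by rewrite c0 ?scale0r //; case: l l0 l1 => [[|[|l]] ll].
move=> [c [c01 c0 xE]]; pose k := Ordinal mn.
have {}IH := IH m2 (ltnW mn).
pose z := x - c k *: e k.
have zZ : zonotope n m z.
  exists (fun l => if l == k then 0 else c l); split=> [l|l ml|].
  - by case: ifP; rewrite // lexx ler01.
  - case: eqP => // lk; apply: c0; rewrite ltn_neqAle ml andbT.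
    by apply: contra_notN lk => /eqP ml'; apply: val_inj.
  - rewrite /z xE (bigD1 k) //= addrAC subrr add0r [RHS](bigD1 k) //= eqxx scale0r add0r.
    by apply: eq_bigr => l /negPf->.
pose w l := cross (e l) (e k); pose s := cross x (e k).
have w0 l : (l < m)%N -> 0 < w l by move=> lm; apply: cross_dir_gt0.
have sE : s = \sum_(l : 'I_n | (l < m)%N) c l * w l.
  rewrite /s crossC xE linear_sum -sumrN [RHS]big_mkcond; apply: eq_bigr => l _ /=.
  rewrite crossZr -mulrN -crossC; case: ifPn => // ; rewrite -leqNgt leq_eqVlt.
  move=> /predU1P[ml|ml]; last by rewrite c0 ?mul0r.
  by rewrite (_ : l = k) ?crossuu ?mulr0 //; apply: val_inj.
have [|l lm||j jm /andP[sj1 sj2]] := @locate_weight m w s.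
- by rewrite (ltnW (m2 : (1 < m)%N)) ltnW.
- exact/ltW/w0.
- rewrite sE sumr_ge0 /= => [|l lm].
  2: by rewrite mulr_ge0 ?(ltW (w0 _ lm)) //; case/andP: (c01 l).
  by apply: ler_sum => l lm; rewrite ler_piMl ?(ltW (w0 _ lm)) //; case/andP: (c01 l).
have wj := w0 j jm.
set tj := \sum_(l : 'I_n | (j < l < m)%N) w l in sj1 sj2.
pose a := (s - tj) / w j.
have a01 : 0 <= a <= 1.
  apply/andP; split; first by apply: divr_ge0; [rewrite subr_ge0 | exact: ltW].
  by rewrite ler_pdivrMr // mul1r lerBlDr.
pose y := \sum_(l : 'I_n | (j < l < m)%N) e l + a *: e j.
have ys : cross y (e k) = s.
  rewrite crossC /y crossDr crossZr linear_sum opprD -sumrN.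
  under eq_bigr do rewrite -crossC.
  by rewrite -mulrN -crossC /a divfK ?gt_eqF // addrC subrK.
pose b := dot (e k) (x - y).
have xyb : x = y + b *: e k.
  have : cross (e k) (x - y) = 0 by rewrite crossBr ![cross (e k) _]crossC ys /s subrr.
  by move/on_line; rewrite /b => <-; rewrite addrC subrK.
have b1 : b <= 1.
  have cjk := cross_dir_gt0 R (jm : (j < k)%N).
  have ex : cross (e j) x <= \sum_(l : 'I_n | (j < l < m)%N) cross (e j) (e l) + cross (e j) (e k).
    rewrite -[x](subrK (c k *: e k)) -/z crossDr lerD ?zonotope_cross_le // crossZr.
    by rewrite ler_piMl ?(ltW cjk) //; case/andP: (c01 k).
  have ey : cross (e j) y = \sum_(l : 'I_n | (j < l < m)%N) cross (e j) (e l).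
    by rewrite /y crossDr crossZr crossuu mulr0 addr0 linear_sum.
  have : b * cross (e j) (e k) <= 1 * cross (e j) (e k).
    by move: ex; rewrite {1}xyb crossDr crossZr ey mul1r lerD2l.
  by rewrite ler_pM2r.
have [b0|b0] := leP 0 b.
  exists (mk_face (jm : (j < k)%N)); first exact: ltnSn.
  exists a, b; rewrite b0 b1; split=> //.
have bc : b - c k < 0 by case/andP: (c01 k) => ? _; lra.
case: zZ => d [d01 d0 zE].
have zb : z = y + (b - c k) *: e k by rewrite /z xyb scalerBl addrA.
pose th := b / (b - c k).
have th01 : 0 <= th <= 1.
  rewrite /th -mulrNN -invrN divr_ge0 ?oppr_ge0 ?(ltW b0) ?(ltW bc) //= ler_pdivrMr ?oppr_gt0 //.
  by rewrite mul1r lerN2 gerBl; case/andP: (c01 k).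
have xth : x = (1 - th) *: y + th *: z.
  have thb : th * (b - c k) = b by rewrite divfK // lt_eqF.
  by rewrite zb [th *: _]scalerDr scalerA thb addrA -scalerDl subrK scale1r.
pose cy l := if (j < l < m)%N then 1 else if l == j then a else 0.
have yE : y = \sum_l cy l *: e l.
  rewrite /y addrC [RHS](bigD1 j) //=; congr (_ + _); first by rewrite /cy ltnn eqxx.
  rewrite big_mkcond [RHS]big_mkcond; apply: eq_bigr => l _; rewrite /cy -val_eqE /=.
  case: ifP => [/andP[jl _]|_]; first by rewrite (gtn_eqF jl) scale1r.
  by case: eqP => //= _; rewrite scale0r.
have [|f fm fx] := IH; last by exists f => //; rewrite (ltn_trans fm).
exists (fun l => th * d l + (1 - th) * cy l); split=> [l|l ml|].
- apply: convex_comb01 => //; rewrite /cy; case: ifP => _; first by rewrite ler01 lexx.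
  by case: ifP; rewrite ?lexx ?ler01.
- rewrite d0 // mulr0 add0r /cy [(l < m)%N]ltnNge ml andbF -val_eqE /=.
  by rewrite (gtn_eqF (leq_trans jm ml)) mulr0.
- rewrite {1}xth addrC zE yE !scaler_sumr -big_split /=; apply: eq_bigr => l _.
  by rewrite [RHS]scalerDl !scalerA.
Qed.

Lemma std_tiling_exists : exists T : tiling R n, pos T = std_pos R (n := n).
Proof.
have cov : \bigcup_(f in [set: face n]) rhombus f (std_pos R f) = @polygon R n.
  rewrite polygonE; apply/seteqP; split=> x.
    move=> [f _ /std_rhombus_zonotope[c [c01 c0 ->]]]; exists c; split=> // i ni.
    by have := ltn_ord i; rewrite ltnNge ni.
  by move=> /std_cover; rewrite hn leqnn => -[//|f _ fx]; exists f.
by exists (Tiling cov (@std_disjoint R n)).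
Qed.

End StandardTiling.

(** * Strips lead from the right to the left boundary *)

Section Telescope.
Variables (R : realType) (n : nat) (hn : (2 <= n)%N).
Notation plane := 'rV[R]_2.
Notation e j := (dir R j).
Implicit Types (T : tiling R n) (i j k l : 'I_n) (f g : face n) (x y z : plane).

(** The starting points of the two edges of direction e_i of the polygon. *)
Definition right_end i : plane := \sum_(l : 'I_n | (l < i)%N) e l.
Definition left_end i : plane := \sum_(l : 'I_n | (i < l)%N) e l.

Lemma strip_sum i (F : 'I_n -> 'I_n -> nat) :
  (\sum_(f : face n | in_face i f) F (fst_dir f) (snd_dir f) =
   \sum_(k : 'I_n | (k < i)%N) F k i + \sum_(k : 'I_n | (i < k)%N) F i k)%N.
Proof.
rewrite (bigID (fun f => i == fst_dir f)) /= addnC; congr addn.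
  rewrite [RHS](reindex_omap (@fst_dir n) (fun k => insub (k, i))) => [|k ki] /=.
    apply: eq_big => [f|f /andP[/orP[->//|/eqP<- //]]].
    have fs := face_lt f; rewrite /in_face; apply/andP/andP.
      move=> [/orP[->//|/eqP iE _]]; rewrite iE; split=> //.
      by rewrite -surjective_pairing valK.
    move=> [fi /eqP/(congr1 (omap val))/=]; rewrite insubT //= => -[].
    rewrite [val f]surjective_pairing => -[iE]; rewrite iE eqxx orbT; split=> //.
    by rewrite -iE -val_eqE /= (gtn_eqF fi).
  by rewrite insubT.
rewrite [RHS](reindex_omap (@snd_dir n) (fun k => insub (i, k))) => [|k ki] /=.
  apply: eq_big => [f|f /andP[_ /eqP<- //]].
  have fs := face_lt f; rewrite /in_face; apply/andP/andP.
    by move=> [_ /eqP->]; split=> //; rewrite -surjective_pairing valK.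
  move=> [fi /eqP/(congr1 (omap val))/=]; rewrite insubT //= => -[].
  by rewrite [val f]surjective_pairing => -[iE]; rewrite iE eqxx.
by rewrite insubT.
Qed.

Lemma std_telescope T i (a : plane -> nat) : pos T = std_pos R (n := n) ->
  (a (right_end i) + \sum_(f | in_face i f) a (exit T i f) =
   a (left_end i) + \sum_(f | in_face i f) a (entry T i f))%N.
Proof.
move=> posE.
pose s m : plane := \sum_(l : 'I_n | (m <= l < i)%N) e l.
pose u m : plane := \sum_(l : 'I_n | (i < l < m)%N) e l.
have sS k : (k < i)%N -> s k = e k + s k.+1.
  move=> ki; rewrite /s (bigD1 k) ?leqnn //=; congr (_ + _); apply: eq_bigl => l.
  by rewrite andbC [in RHS]ltn_neqAle -[RHS]andbA eq_sym.
have uS k : (i < k)%N -> u k.+1 = u k + e k.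
  move=> ik; rewrite /u (bigD1 k) ?ik ?ltnSn //= addrC; congr (_ + _); apply: eq_bigl => l.
  by rewrite -andbA; congr (_ && _); rewrite ltnS [in RHS]ltn_neqAle andbC.
pose F0 k l := if i == k then a (u l) else a (s k).
pose F1 k l := if i == k then a (u l.+1) else a (s k.+1).
have -> : (\sum_(f | in_face i f) a (entry T i f) =
    \sum_(f : face n | in_face i f) F0 (fst_dir f) (snd_dir f))%N.
  apply: eq_bigr => f fif; rewrite /F0 /entry posE; case: ifP => [/eqP iE|fi].
    by rewrite /u /std_pos -iE.
  have fs : (fst_dir f < i)%N by rewrite (in_face_snd fif fi) face_lt.
  by rewrite sS // [in RHS]addrC /std_pos -(in_face_snd fif fi).
have -> : (\sum_(f | in_face i f) a (exit T i f) =
    \sum_(f : face n | in_face i f) F1 (fst_dir f) (snd_dir f))%N.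
  apply: eq_bigr => f fif; rewrite /F1 /exit /entry /step posE; case: ifP => [/eqP iE|fi].
    have ifs : (i < snd_dir f)%N by rewrite iE face_lt.
    by rewrite uS // /u /std_pos -iE.
  by rewrite addrK /std_pos -(in_face_snd fif fi).
have uN : left_end i = u n by apply: eq_bigl => l; rewrite ltn_ord andbT.
have s0 : right_end i = s 0%N by [].
have si : s i = u i.+1.
  by rewrite /s /u !big1 // => l lh; exfalso; lia.
rewrite !strip_sum s0 uN.
have nki k : (k < i)%N -> (i == k) = false by move=> ki; rewrite -val_eqE /= (gtn_eqF ki).
rewrite (eq_bigr (fun k : 'I_n => a (s k.+1))) => [|k ki]; last by rewrite /F1 nki.
rewrite [X in (_ + (_ + X) = _)%N](eq_bigr (fun k : 'I_n => a (u k.+1))) => [|k ki];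
  last by rewrite /F1 eqxx.
rewrite [X in (_ = _ + (X + _))%N](eq_bigr (fun k : 'I_n => a (s k))) => [|k ki];
  last by rewrite /F0 nki.
rewrite [X in (_ = _ + (_ + X))%N](eq_bigr (fun k : 'I_n => a (u k))) => [|k ki];
  last by rewrite /F0 eqxx.
have lowE (G : nat -> nat) : (\sum_(k : 'I_n | (k < i)%N) G k = \sum_(0 <= m < i) G m)%N.
  by rewrite (big_nat_widen _ _ n) ?(ltnW (ltn_ord i)) // big_mkord.
have highE (G : nat -> nat) : (\sum_(k : 'I_n | (i < k)%N) G k = \sum_(i.+1 <= m < n) G m)%N.
  by rewrite (big_nat_widenl _ 0%N) // big_mkord.
rewrite (lowE (fun m => a (s m.+1))) (lowE (fun m => a (s m))).
rewrite (highE (fun m => a (u m.+1))) (highE (fun m => a (u m))).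
rewrite addnA -(big_nat_recl i 0%N (fun m => a (s m))) // big_nat_recr //= si -addnA.
rewrite -(big_nat_recl n i.+1 (fun m => a (u m))) ?ltn_ord // big_nat_recr ?ltn_ord //=.
lia.
Qed.

Definition strip i := [seq f <- index_enum (face n) | in_face i f].

(** The rhombi of a strip fit together edge to edge: each one is entered where
    another one, or the outside of the polygon, is left. By [segment_count] it
    suffices to see this for the standard tiling. *)
Lemma strip_perm T i :
  perm_eq (right_end i :: map (exit T i) (strip i)) (left_end i :: map (entry T i) (strip i)).
Proof.
have [T0 posE] := std_tiling_exists R hn.
apply: (@segments_perm _ _ i) => x /=.
have cnt (h : face n -> plane) : count (in_segment i ^~ x) (map h (strip i)) =
    (\sum_(f | in_face i f) in_segment i (h f) x)%N.
  by rewrite -sum1_count big_map big_filter_cond big_mkcondr.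
rewrite !cnt; have := segment_count T T0 i x.
have := std_telescope i (fun y => nat_of_bool (in_segment i y x)) posE; rewrite /=; lia.
Qed.

(** This form spares ordering the rhombi of the strip: functions phi that
    vanish above some height give access to its initial segments. *)
Lemma strip_telescope (V : nmodType) T i (phi : plane -> V) :
  phi (right_end i) + \sum_(f | in_face i f) phi (exit T i f) =
  phi (left_end i) + \sum_(f | in_face i f) phi (entry T i f).
Proof.
have : \sum_(y <- right_end i :: map (exit T i) (strip i)) phi y =
  \sum_(y <- left_end i :: map (entry T i) (strip i)) phi y by apply/perm_big/strip_perm.
by rewrite !big_cons !big_map !big_filter.
Qed.

Lemma strip_telescope_nat T i (phi : plane -> nat) :
  (phi (right_end i) + \sum_(f | in_face i f) phi (exit T i f) =
   phi (left_end i) + \sum_(f | in_face i f) phi (entry T i f))%N.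
Proof.
have : (\sum_(y <- right_end i :: map (exit T i) (strip i)) phi y =
  \sum_(y <- left_end i :: map (entry T i) (strip i)) phi y)%N by apply/perm_big/strip_perm.
by rewrite !big_cons !big_map !big_filter.
Qed.

End Telescope.

(** * The position of a point relative to a strip *)

Section RealContinuity.
Variable R : realType.
Implicit Types f g : R -> R.

Lemma contD f g : continuous f -> continuous g -> continuous (fun s => f s + g s).
Proof. by move=> cf cg s; exact: (cvgD (@cf s) (@cg s)). Qed.

Lemma contM f g : continuous f -> continuous g -> continuous (fun s => f s * g s).
Proof. by move=> cf cg s; exact: (cvgM (@cf s) (@cg s)). Qed.

Lemma contN f : continuous f -> continuous (fun s => - f s).
Proof. by move=> cf s; exact: (cvgN (@cf s)). Qed.

Lemma cont_norm f : continuous f -> continuous (fun s => `|f s|).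
Proof. by move=> cf s; exact: (cvg_norm (@cf s)). Qed.

Lemma cont_cst (a : R) : continuous (fun _ : R => a).
Proof. exact: cst_continuous. Qed.

Lemma cont_id : continuous (fun s : R => s).
Proof. by move=> s; exact: cvg_id. Qed.

Lemma cont_sum (I : finType) (P : pred I) (F : I -> R -> R) :
  (forall i, continuous (F i)) -> continuous (fun s => \sum_(i | P i) F i s).
Proof.
move=> cF; elim: (index_enum I) => [|i r IH].
  by under eq_fun do rewrite big_nil; exact: cont_cst.
under eq_fun do rewrite big_cons; case: (P i) => //.
exact: contD.
Qed.

End RealContinuity.

Section Labels.
Variables (R : realType) (n : nat) (hn : (2 <= n)%N) (T : tiling R n).
Notation plane := 'rV[R]_2.
Notation e j := (dir R j).
Implicit Types (i j k l : 'I_n) (f g : face n) (x y z : plane).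

Section OneStrip.
Variable i : 'I_n.
Let t x := cross (e i) x.
Let h f := t (step R i f).

(** Telescoping the indicator function of the half plane t <= tau counts the
    rhombi of the strip that are crossed by the line t = tau. *)
Lemma strip_active (tau : R) :
  ((t (right_end R i) <= tau)%R = (t (left_end R i) <= tau)%R +
   \sum_(f | in_face i f) (t (entry T i f) <= tau < t (exit T i f))%R :> nat)%N.
Proof.
have := strip_telescope_nat hn T i (fun x => nat_of_bool (t x <= tau)).
have -> : (\sum_(f | in_face i f) (t (entry T i f) <= tau)%R =
    \sum_(f | in_face i f) (t (exit T i f) <= tau)%R +
    \sum_(f | in_face i f) (t (entry T i f) <= tau < t (exit T i f))%R)%N.
  rewrite -big_split; apply: eq_bigr => f fif /=.
  have : t (entry T i f) <= t (exit T i f).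
    by rewrite /exit /t crossDr lerDl ltW // cross_step.
  by case: (leP (t (exit T i f)) tau) => h2 h3; rewrite ?(le_trans h3 h2) ?andbF ?andbT.
lia.
Qed.

Lemma strip_active_unique f g (tau : R) : in_face i f -> in_face i g ->
  t (entry T i f) <= tau < t (exit T i f) -> t (entry T i g) <= tau < t (exit T i g) -> f = g.
Proof.
move=> fif fig hf hg; apply/eqP/negPn/negP => fg.
have := strip_active tau; rewrite (bigD1 f) //= hf (bigD1 g) /=; last by rewrite fig eq_sym.
by rewrite hg; case: (t (right_end R i) <= tau); case: (t (left_end R i) <= tau); lia.
Qed.

Lemma strip_active_exists (tau : R) : t (right_end R i) <= tau < t (left_end R i) ->
  exists2 f, in_face i f & t (entry T i f) <= tau < t (exit T i f).
Proof.
move=> /andP[rt tl]; have := strip_active tau; rewrite rt leNgt tl /= add0n.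
case: (pickP (fun f => in_face i f && (t (entry T i f) <= tau < t (exit T i f)))) => [f /andP[]|no].
  by exists f.
by rewrite big1 // => f fif; have := no f; rewrite fif /= => ->.
Qed.

(** The coordinate along e_i, at height t = tau, of the lower side of the strip,
    which is a path with the steps [step R i f]. The quotient clamps
    (tau - t (entry T i f)) / h f to [0, 1], which gives continuity without
    ordering the rhombi. *)
Definition strip_path (tau : R) : R := dot (e i) (right_end R i) +
  \sum_(f | in_face i f) dot (e i) (step R i f) *
    ((`|tau - t (entry T i f)| - `|tau - t (exit T i f)| + h f) / (2 * h f)).

(** The position of x relative to the strip, in units of e_i: between 0 and 1 in
    the strip, at most 0 before and at least 1 beyond it. *)
Definition offset x : R := dot (e i) x - strip_path (t x).

Lemma strip_path_continuous : continuous strip_path.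
Proof.
apply: contD; first exact: cont_cst.
apply: cont_sum => f; apply: contM; first exact: cont_cst.
apply: contM; last exact: cont_cst.
apply: contD; last exact: cont_cst.
apply: contD; [|apply: contN]; apply: cont_norm; apply: contD;
  by [exact: cont_id | exact: cont_cst].
Qed.

(** Telescope the function phi equal to the coordinate along e_i below the height of
    the entry of f and to 0 above: the rhombi crossed before f contribute
    their full step, those crossed after f contribute nothing. *)
Lemma strip_pathE f (b : R) : in_face i f -> 0 <= b <= 1 ->
  strip_path (t (entry T i f) + b * h f) = dot (e i) (entry T i f) + b * dot (e i) (step R i f).
Proof.
move=> fif /andP[b0 b1]; set tau := t (entry T i f) + _.
have hg g : in_face i g -> 0 < h g by exact: cross_step.
have texit g : t (exit T i g) = t (entry T i g) + h g by rewrite /exit /t crossDr.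
have tf := hg f fif.
have tau_f : t (entry T i f) <= tau <= t (exit T i f).
  by rewrite texit lerDl lerD2l mulr_ge0 ?(ltW tf) //= ler_piMl // ltW.
pose tf0 := t (entry T i f); pose phi x := if t x <= tf0 then dot (e i) x else 0.
have phiT x : t x <= tf0 -> phi x = dot (e i) x by rewrite /phi => ->.
have phiF x : tf0 < t x -> phi x = 0 by rewrite /phi ltNge => /negPf->.
have act : (t (right_end R i) <= tf0) && ~~ (t (left_end R i) <= tf0).
  have := strip_active tf0; rewrite (bigD1 f) //= lexx texit ltrDl tf /=.
  by case: (t (right_end R i) <= tf0); case: (t (left_end R i) <= tf0); lia.
have tel : dot (e i) (right_end R i) + \sum_(g | in_face i g) phi (exit T i g) =
    \sum_(g | in_face i g) phi (entry T i g).
  have := strip_telescope hn T i phi; case/andP: act => /phiT->.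
  by rewrite -ltNge => /phiF->; rewrite add0r.
have term g : in_face i g -> dot (e i) (step R i g) *
    ((`|tau - t (entry T i g)| - `|tau - t (exit T i g)| + h g) / (2 * h g)) =
  (phi (exit T i g) - phi (entry T i g)) +
   if g == f then dot (e i) (entry T i f) + b * dot (e i) (step R i f) else 0.
  move=> fig; have h0 := hg g fig; have h1 : h g != 0 by rewrite gt_eqF.
  have [->|gf] := eqVneq g f.
    rewrite (phiT (entry T i f)) // (phiF (exit T i f)) ?texit ?ltrDl //.
    rewrite -texit sub0r addKr.
    have -> : tau - t (entry T i f) = b * h f by rewrite /tau; ring.
    have -> : tau - t (exit T i f) = - ((1 - b) * h f) by rewrite /tau texit; ring.
    have b1' : 0 <= 1 - b by rewrite subr_ge0.
    rewrite normrN (ger0_norm (mulr_ge0 b0 (ltW tf))) (ger0_norm (mulr_ge0 b1' (ltW tf))).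
    by field; rewrite gt_eqF.
  have /orP[le_exit|lt_exit] : (t (exit T i g) <= tf0) || (tf0 < t (exit T i g)).
    by rewrite ltNge orbN.
    rewrite !phiT //; last by apply: le_trans le_exit; rewrite texit lerDl ltW.
    have te : t (exit T i g) <= tau by apply: le_trans le_exit _; case/andP: tau_f.
    have te' : t (entry T i g) <= tau by apply: le_trans te; rewrite texit lerDl ltW.
    have [d d'] : 0 <= tau - t (exit T i g) /\ 0 <= tau - t (entry T i g) by rewrite !subr_ge0.
    by rewrite addr0 (ger0_norm d) (ger0_norm d') texit /exit dotDr; field.
  have lt_entry : tf0 < t (entry T i g).
    rewrite ltNge; apply/negP => hle; case/eqP: gf; apply: (@strip_active_unique g f tf0) => //.
      by rewrite hle.
    by rewrite lexx texit ltrDl.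
  have te : t (exit T i f) <= t (entry T i g).
    rewrite leNgt; apply/negP => hlt; case/eqP: gf.
    apply: (@strip_active_unique g f (t (entry T i g))) => //.
      by rewrite lexx texit ltrDl.
    by rewrite (ltW lt_entry).
  rewrite !phiF // subrr !add0r.
  have ta : tau <= t (entry T i g) by apply: le_trans te; case/andP: tau_f.
  have ta' : tau <= t (exit T i g) by apply: le_trans ta _; rewrite texit lerDl ltW.
  have [d d'] : tau - t (exit T i g) <= 0 /\ tau - t (entry T i g) <= 0 by rewrite !subr_le0.
  by rewrite (ler0_norm d) (ler0_norm d') texit; field.
rewrite /strip_path (eq_bigr _ term) big_split /= sumrB.
set v := _ + b * _.
have -> : \sum_(g | in_face i g) (if g == f then v else 0) = v.
  rewrite -big_mkcondr /= (bigD1 f) ?fif ?eqxx //= big1 ?addr0 //.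
  by move=> g /andP[/andP[_ /eqP->]]; rewrite eqxx.
by rewrite /v addrA addrCA -tel; ring.
Qed.

Lemma offset_strip f (a b : R) : in_face i f -> 0 <= b <= 1 ->
  offset (entry T i f + b *: step R i f + a *: e i) = a.
Proof.
move=> fif b01; rewrite /offset.
have -> : t (entry T i f + b *: step R i f + a *: e i) = t (entry T i f) + b * h f.
  by rewrite /t !crossDr !crossZr crossuu mulr0 addr0.
by rewrite strip_pathE // !dotDr !dotZr dot_dir; ring.
Qed.

Lemma strip_coordinates f x : in_face i f -> t (entry T i f) <= t x <= t (exit T i f) ->
  exists2 b, 0 <= b <= 1 & x = entry T i f + b *: step R i f + offset x *: e i.
Proof.
move=> fif /andP[h1 h2]; have h0 : 0 < h f := cross_step R fif.
have b01 : 0 <= (t x - t (entry T i f)) / h f <= 1.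
  apply/andP; split; first by apply: divr_ge0; [rewrite subr_ge0 | exact: ltW].
  by rewrite ler_pdivrMr // mul1r lerBlDr addrC -crossDr.
exists ((t x - t (entry T i f)) / h f) => //; set b := _ / _ in b01 *.
have tx : t x = t (entry T i f) + b * h f by rewrite /b divfK ?gt_eqF // addrC subrK.
apply: (@eq_dot_cross _ _ i).
  by rewrite !dotDr !dotZr dot_dir /offset tx strip_pathE //; ring.
by rewrite !crossDr !crossZr crossuu mulr0 addr0.
Qed.

End OneStrip.
End Labels.

(** * Labels of points *)

Section VertexLabels.
Variables (R : realType) (n : nat) (hn : (2 <= n)%N) (T : tiling R n).
Notation plane := 'rV[R]_2.
Notation e j := (dir R j).
Implicit Types (i j k l : 'I_n) (f g : face n) (x y z : plane).

Lemma zonotope_cross_ge m j x : zonotope n m x ->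
  cross (e j) (right_end R j) <= cross (e j) x.
Proof.
move=> [c [c01 c0 ->]]; rewrite !linear_sum [leLHS]big_mkcond; apply: ler_sum => l _ /=.
have /andP[cl0 cl1] := c01 l; rewrite crossZr.
have [lj|] := ltnP l j.
  by rewrite crossC mulrN lerN2 ler_piMl // ltW // cross_dir_gt0.
rewrite leq_eqVlt => /predU1P[/val_inj->|jl]; first by rewrite crossuu mulr0.
by rewrite mulr_ge0 // ltW // cross_dir_gt0.
Qed.

Lemma rhombus_zonotope f x : rhombus f (pos T f) x -> zonotope n n x.
Proof. by move=> /rhombus_polygon; rewrite polygonE. Qed.

Lemma cross_left_end i x : zonotope n n x -> cross (e i) x <= cross (e i) (left_end R i).
Proof.
move=> /(zonotope_cross_le i)/le_trans; apply; rewrite linear_sum.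
by rewrite le_eqVlt; apply/orP; left; apply/eqP; apply: eq_bigl => l; rewrite ltn_ord andbT.
Qed.

(** Otherwise x would also be in a rhombus of the strip i. *)
Lemma strip_avoid i f x : ~~ in_face i f -> open_rhombus T f x -> ~~ (0 < offset T i x < 1).
Proof.
move=> fi fx; apply/negP => /andP[off0 off1].
have Df := lt0r_neq0 (face_cross R f).
have [s s0 [xs _]] := interior_line (perp (e i)) (open_para_interior Df fx).
have tl : cross (e i) x < cross (e i) (left_end R i).
  apply: lt_le_trans (cross_left_end i (rhombus_zonotope xs)).
  by rewrite crossDr crossZr cross_perp_dir mulr1 ltrDl.
have tr : cross (e i) (right_end R i) <= cross (e i) x.
  exact: zonotope_cross_ge (rhombus_zonotope (open_rhombus_sub fx)).
have [|g gi /andP[tg1 tg2]] := @strip_active_exists _ _ hn T i (cross (e i) x).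
  by rewrite tr tl.
have [|b b01 xE] := @strip_coordinates _ _ hn T i g x gi; first by rewrite tg1 ltW.
have xg : rhombus g (pos T g) x.
  apply/(strip_rhombusP _ _ gi); exists (offset T i x), b; split=> //; first by rewrite !ltW.
  by rewrite {1}xE addrAC.
by move: fi; rewrite (open_rhombus_meet fx xg) gi.
Qed.

(** Otherwise the offset would take a value in ]0, 1[ on a path from x to y
    in the interior of the rhombus, contrary to [strip_avoid]. *)
Lemma offset_other i f x y : ~~ in_face i f ->
  rhombus f (pos T f) x -> rhombus f (pos T f) y -> 1 <= offset T i x -> 1 <= offset T i y.
Proof.
move=> fi [a [b [a01 b01 xE]]] [a' [b' [a'01 b'01 yE]]] ox.
rewrite leNgt; apply/negP => oy.
pose c := pos T f + 2^-1 *: e (fst_dir f) + 2^-1 *: e (snd_dir f).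
(* A quadratic Bezier curve with control point c: unlike the segment, it is in
   the open rhombus for 0 < s < 1 even if x and y are on one edge. *)
pose z s : plane := ((1 - s) ^+ 2) *: x + (2 * s * (1 - s)) *: c + (s ^+ 2) *: y.
have zopen s : 0 < s < 1 -> open_rhombus T f (z s).
  move=> /andP[s0 s1].
  exists ((1 - s) ^+ 2 * a + s * (1 - s) + s ^+ 2 * a'),
         ((1 - s) ^+ 2 * b + s * (1 - s) + s ^+ 2 * b').
  have pq : 0 < s * (1 - s) by rewrite mulr_gt0 // subr_gt0.
  have bnd p q : 0 <= p <= 1 -> 0 <= q <= 1 ->
      0 < (1 - s) ^+ 2 * p + s * (1 - s) + s ^+ 2 * q < 1.
    move=> /andP[p0 p1] /andP[q0 q1].
    have h1 := mulr_ge0 (sqr_ge0 (1 - s)) p0; have h2 := mulr_ge0 (sqr_ge0 s) q0.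
    have h3 : (1 - s) ^+ 2 * p <= (1 - s) ^+ 2 by rewrite ler_piMr // sqr_ge0.
    have h4 : s ^+ 2 * q <= s ^+ 2 by rewrite ler_piMr // sqr_ge0.
    apply/andP; split; first by lra.
    have : (1 - s) ^+ 2 + s * (1 - s) + s ^+ 2 = 1 - s * (1 - s) by ring.
    by lra.
  split; [exact: bnd | exact: bnd |].
  by rewrite /z /c xE yE; apply: plane_eqP; rewrite !mxE; field.
pose g s := offset T i (z s).
have gc : continuous g.
  have quad (u : plane -> R) : (forall r p q, u (r *: p + q) = r * u p + u q) ->
      continuous (fun s => u (z s)).
    move=> lin; have -> : (fun s => u (z s)) =
        (fun s => (1 + - s) * (1 + - s) * u x + (s + s) * (1 + - s) * u c + s * s * u y).
      apply/funext => s; rewrite /z -addrA !lin -[_ *: y]addr0 lin.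
      have -> : u 0 = 0 by have := lin (-1) 0 0; rewrite scaler0 addr0; lra.
      by ring.
    have c1 : continuous (fun s : R => 1 + - s).
      by apply: contD; [exact: cont_cst | exact: contN (@cont_id R)].
    apply: contD; [apply: contD|]; apply: contM; try exact: cont_cst.
    - exact: contM.
    - by apply: contM => //; apply: contD; exact: cont_id.
    - by apply: contM; exact: cont_id.
  apply: contD.
    by apply: quad => r p q; rewrite dotDr dotZr.
  apply: contN => s.
  have ct : continuous (fun s => cross (e i) (z s)).
    by apply: quad => r p q; rewrite crossDr crossZr.
  exact: (continuous_comp (@ct s) (@strip_path_continuous _ _ T i _)).
have g0 : g 0 = offset T i x.
  by rewrite /g /z; congr offset; apply: plane_eqP; rewrite !mxE; ring.
have g1 : g 1 = offset T i y.
  by rewrite /g /z; congr offset; apply: plane_eqP; rewrite !mxE; ring.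
pose v := (Num.max (g 1) 0 + 1) / 2.
have m1 : Num.max (g 1) 0 < 1 by rewrite gt_max g1 oy ltr01.
have [mg m0] : g 1 <= Num.max (g 1) 0 /\ 0 <= Num.max (g 1) 0 by rewrite !le_max !lexx orbT.
have v01 : 0 < v < 1 by rewrite /v; apply/andP; split; lra.
have gv : g 1 < v by rewrite /v; lra.
have vg : v < g 0 by rewrite g0; case/andP: v01 => _ /lt_le_trans; apply.
have [||s] := @IVT R g 0 1 v ler01.
- exact: continuous_subspaceT.
- by rewrite ge_min le_max (ltW gv) (ltW vg) !orbT.
rewrite in_itv /= => /andP[s0 s1] gs.
have s0' : 0 < s by rewrite lt_neqAle s0 andbT; apply/eqP => s0E; move: vg; rewrite s0E gs ltxx.
have s1' : s < 1 by rewrite lt_neqAle s1 andbT; apply/eqP => s1E; move: gv; rewrite -s1E gs ltxx.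
have /(strip_avoid fi) := zopen s (introT andP (conj s0' s1')).
by rewrite -/(g s) gs v01.
Qed.

(** The strips that have to be crossed to reach x from below. *)
Definition label x : {set 'I_n} := [set i | 1 <= offset T i x]%SET.

(** In the strips of its own two directions the offset is a coordinate of the
    rhombus, and all its corners are on the same side of the other strips. *)
Lemma label_corner f (a b : bool) i : i \in label (corner_pt T f a b) =
  if i == fst_dir f then a else if i == snd_dir f then b else i \in label (pos T f).
Proof.
have b01 (c : bool) : (0 : R) <= c%:R <= 1 by case: c; rewrite ?lexx ler01.
have sn (c : bool) : ((1 : R) <= c%:R) = c by case: c; rewrite ?lexx // ler10.
rewrite inE; case: ifPn => [/eqP iE|i1].
  have fi : in_face i f by rewrite /in_face iE eqxx.
  have -> : corner_pt T f a b = entry T i f + b%:R *: step R i f + a%:R *: e i.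
    by rewrite /corner_pt /entry /step iE eqxx addrAC.
  by rewrite offset_strip ?sn ?hn ?b01.
case: ifPn => [/eqP iE|i2].
  have fi : in_face i f by rewrite /in_face iE eqxx orbT.
  have -> : corner_pt T f a b = entry T i f + (~~ a)%:R *: step R i f + b%:R *: e i.
    rewrite /corner_pt /entry /step (negPf i1) iE.
    by case: a => /=; apply: plane_eqP; rewrite !mxE; ring.
  by rewrite offset_strip ?sn ?hn ?b01.
have fi : ~~ in_face i f by rewrite negb_or i1 i2.
have rc a' b' : rhombus f (pos T f) (corner_pt T f a' b').
  by exists a'%:R, b'%:R; rewrite !b01; split.
have r0 : rhombus f (pos T f) (pos T f).
  by exists 0, 0; rewrite lexx ler01 !scale0r !addr0; split.
rewrite inE; apply/idP/idP; first exact: (offset_other fi (rc a b) r0).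
exact: (offset_other fi r0 (rc a b)).
Qed.

Lemma label_posN f : (fst_dir f \notin label (pos T f)) * (snd_dir f \notin label (pos T f)).
Proof.
have c00 : pos T f = corner_pt T f false false by rewrite /corner_pt !scale0r !addr0.
rewrite c00 !label_corner eqxx; split=> //.
by rewrite -val_eqE /= (gtn_eqF (face_lt f)) eqxx.
Qed.

(** If 0 were beyond the strip i, then 0 = q + c e_i with q in the polygon and
    c >= 1, which is impossible because a linear form that is nonnegative on
    the polygon and positive at e_i exists: the cross product with the last
    direction, unless i is the last direction. In this case 0 is an end
    of the lower side of the strip. *)
Lemma label0 : label 0 = finset.set0.
Proof.
apply/setP => i; rewrite !inE; apply/negP => off1.
have last_lt : (n.-1 < n)%N by rewrite prednK // ltnW.
pose m := Ordinal last_lt.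
have [im|im] := ltnP i m; last first.
  have l0 : left_end R i = 0.
    rewrite /left_end big1 // => l il; have := ltn_ord l.
    by move: im il => /=; lia.
  have r0 : cross (e i) (right_end R i) < 0.
    have i1 : (0 < i)%N by move: im => /=; lia.
    rewrite linear_sum (bigD1 (Ordinal (ltnW hn))) //= ltr_wnDr //.
      rewrite -oppr_ge0 -sumrN sumr_ge0 // => l /andP[li _].
      by rewrite -crossC ltW // cross_dir_gt0.
    by rewrite crossC oppr_lt0 cross_dir_gt0.
  have := strip_telescope_nat hn T i (fun x => nat_of_bool (x == 0)).
  rewrite l0 eqxx; case: eqP => [rE|_]; first by move: r0; rewrite rE linear0 ltxx.
  case: (pickP (fun f => in_face i f && (exit T i f == 0))) => [f /andP[fi /eqP fE]|no].
    move: off1; rewrite -fE /exit -[step _ _ _]scale1r -[X in _ + X]addr0 addrA.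
    by rewrite -[X in _ + X](scale0r (e i)) offset_strip ?lexx ?ler01 // ler10.
  by rewrite big1 // => f fi; have := no f; rewrite fi /= => ->.
have P0 : zonotope n n (0 : plane).
  exists (fun=> 0); split=> //; first by rewrite lexx ler01.
  by rewrite big1 // => l _; rewrite scale0r.
have t0 : cross (e i) 0 < cross (e i) (left_end R i).
  rewrite linear0 linear_sum (bigD1 m) //= ltr_pwDl ?cross_dir_gt0 // sumr_ge0 // => l /andP[il _].
  by rewrite ltW // cross_dir_gt0.
have [|g gi /andP[tg1 tg2]] := @strip_active_exists _ _ hn T i (cross (e i) 0).
  by rewrite t0 andbT; apply: zonotope_cross_ge P0.
have [|b b01 xE] := @strip_coordinates _ _ hn T i g 0 gi; first by rewrite tg1 ltW.
set q := entry T i g + b *: step R i g in xE.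
have /rhombus_zonotope[c [c01 _ qE]] : rhombus g (pos T g) q.
  by apply/(strip_rhombusP _ _ gi); exists 0, b; rewrite lexx ler01 scale0r addr0.
have : 0 <= cross q (e m).
  rewrite qE crossC linear_sum -sumrN sumr_ge0 // => l _ /=.
  rewrite crossZr -mulrN -crossC mulr_ge0 //; first by case/andP: (c01 l).
  have : (l <= m)%N by rewrite /= -ltnS prednK // ltnW.
  by rewrite leq_eqVlt => /predU1P[/val_inj->|/(cross_dir_gt0 R)/ltW//]; rewrite crossuu.
have em : 0 < cross (e i) (e m) by exact: cross_dir_gt0.
have := congr1 (cross (e m)) xE; rewrite linear0 crossDr crossZr => E.
rewrite crossC oppr_ge0 => qm.
have : 0 < offset T i 0 * cross (e i) (e m) by rewrite mulr_gt0 // (lt_le_trans ltr01).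
rewrite [cross (e i) _]crossC; lra.
Qed.

End VertexLabels.

(** * Shortest walks *)

Section Walks.
Variables (R : realType) (n : nat) (hn : (2 <= n)%N) (T : tiling R n).
Notation plane := 'rV[R]_2.
Notation e j := (dir R j).
Implicit Types (i j k l : 'I_n) (f g : face n) (x y z : plane).
Let label := label T.

Definition is_edge y i : Prop :=
  exists2 f, in_face i f & y = entry T i f \/ y = exit T i f.

Lemma pos_corner f : pos T f = corner_pt T f false false.
Proof. by rewrite /corner_pt !scale0r !addr0. Qed.

Lemma entry_fst f : entry T (fst_dir f) f = corner_pt T f false false.
Proof. by rewrite /entry eqxx pos_corner. Qed.

Lemma snd_fst f : (snd_dir f == fst_dir f) = false.
Proof. by rewrite -val_eqE /= (gtn_eqF (face_lt f)). Qed.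

Lemma exit_fst f : exit T (fst_dir f) f = corner_pt T f false true.
Proof. by rewrite /exit /step entry_fst eqxx /corner_pt !scale0r scale1r !addr0. Qed.

Lemma entry_snd f : entry T (snd_dir f) f = corner_pt T f true false.
Proof. by rewrite /entry snd_fst /corner_pt scale1r scale0r addr0. Qed.

Lemma exit_snd f : exit T (snd_dir f) f = corner_pt T f false false.
Proof. by rewrite /exit /step /entry snd_fst addrK pos_corner. Qed.

Lemma in_faceP i f : in_face i f -> i = fst_dir f \/ i = snd_dir f.
Proof. by case/orP => /eqP; [left | right]. Qed.

Lemma corner_fst f b : corner_pt T f false b + e (fst_dir f) = corner_pt T f true b.
Proof. by rewrite /corner_pt scale0r addr0 scale1r addrAC. Qed.

Lemma corner_snd f a : corner_pt T f a false + e (snd_dir f) = corner_pt T f a true.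
Proof. by rewrite /corner_pt scale0r addr0 scale1r. Qed.

Lemma is_edge_fst f b : is_edge (corner_pt T f false b) (fst_dir f).
Proof.
exists f; first by rewrite /in_face eqxx.
by rewrite entry_fst exit_fst; case: b; [right | left].
Qed.

Lemma is_edge_snd f a : is_edge (corner_pt T f a false) (snd_dir f).
Proof.
exists f; first by rewrite /in_face eqxx orbT.
by rewrite entry_snd exit_snd; case: a; [left | right].
Qed.

Lemma is_edgeP y i : is_edge y i -> exists f,
  (i = fst_dir f /\ exists b, y = corner_pt T f false b) \/
  (i = snd_dir f /\ exists a, y = corner_pt T f a false).
Proof.
move=> [f /in_faceP[->|->] yE]; exists f; [left | right]; split=> //.
  by case: yE; rewrite ?entry_fst ?exit_fst => ->; [exists false | exists true].
by case: yE; rewrite ?entry_snd ?exit_snd => ->; [exists true | exists false].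
Qed.

Lemma label_edge y i : is_edge y i -> i \notin label y /\ label (y + e i) = (i |: label y)%SET.
Proof.
move=> /is_edgeP[f [[-> [b ->]]|[-> [a ->]]]].
  rewrite corner_fst; split; first by rewrite label_corner // eqxx.
  apply/setP => k; rewrite in_setU1 !label_corner //.
  by case: ifP => //= _; case: ifP.
rewrite corner_snd; split; first by rewrite label_corner // snd_fst eqxx.
apply/setP => k; rewrite in_setU1 !label_corner //.
case: ifP => [/eqP->|_]; first by rewrite eq_sym snd_fst.
by case: ifP.
Qed.

Lemma is_edge_tiling_edge y i : is_edge y i -> tiling_edge T y (y + e i).
Proof.
move=> /is_edgeP[f [[-> [b ->]]|[-> [a ->]]]]; exists f.
  by exists false, b, true, b; rewrite corner_fst eqxx.
by exists a, false, a, true; rewrite corner_snd eqxx.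
Qed.

Lemma is_edge_vertex y i : is_edge y i -> is_vertex T y /\ is_vertex T (y + e i).
Proof.
by move=> /is_edge_tiling_edge[f [a [b [a' [b' [-> -> _]]]]]]; split; do 3!eexists.
Qed.

Lemma tiling_edgeP y z : tiling_edge T y z ->
  exists i, (is_edge y i /\ z = y + e i) \/ (is_edge z i /\ y = z + e i).
Proof.
move=> [f [a [b [a' [b' [-> ->]]]]]].
case: a; case: b; case: a'; case: b' => //= _;
  [exists (snd_dir f); right | exists (fst_dir f); right | exists (snd_dir f); left
  | exists (fst_dir f); right | exists (fst_dir f); left | exists (snd_dir f); right
  | exists (fst_dir f); left | exists (snd_dir f); left];
  by split; rewrite ?corner_fst ?corner_snd //; do ?[exact: is_edge_fst | exact: is_edge_snd].
Qed.

Lemma exists_in_face i : exists f : face n, in_face i f.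
Proof.
have n0 : (0 < n)%N := ltnW hn.
have [i0|i0] := posnP i.
  exists (mk_face (isT : (Ordinal n0 < Ordinal hn)%N)).
  by rewrite /in_face /fst_dir /= -val_eqE /= i0.
by exists (mk_face (i0 : (Ordinal n0 < i)%N)); rewrite /in_face /snd_dir /= eqxx orbT.
Qed.

(** The strip i is not empty, and each of its rhombi is crossed leftwards. *)
Lemma right_neq_left i : right_end R i != left_end R i.
Proof.
have [f fi] := exists_in_face i.
have inP (b : R) : 0 <= b <= 1 -> zonotope n n (entry T i f + b *: step R i f).
  move=> b01; apply: (rhombus_zonotope (T := T) (f := f)); apply/(strip_rhombusP _ _ fi).
  by exists 0, b; rewrite lexx ler01 scale0r addr0.
have h1 : cross (e i) (right_end R i) <= cross (e i) (entry T i f).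
  have c0 : 0 <= (0 : R) <= 1 by rewrite lexx ler01.
  by have := zonotope_cross_ge i (inP _ c0); rewrite scale0r addr0.
have h2 : cross (e i) (exit T i f) <= cross (e i) (left_end R i).
  have c1 : 0 <= (1 : R) <= 1 by rewrite lexx ler01.
  by have := cross_left_end i (inP _ c1); rewrite scale1r.
have h3 : cross (e i) (entry T i f) < cross (e i) (exit T i f).
  by rewrite crossDr ltrDl cross_step.
by apply/eqP => rl; move: (lt_le_trans (le_lt_trans h1 h3) h2); rewrite rl ltxx.
Qed.

Lemma mem_exits i y : (y \in right_end R i :: map (exit T i) (strip i)) =
  (y \in left_end R i :: map (entry T i) (strip i)).
Proof. exact/perm_mem/strip_perm. Qed.

Lemma mem_strip i f : (f \in strip i) = in_face i f.
Proof. by rewrite mem_filter mem_index_enum andbT. Qed.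

(** An edge which is not on the right boundary is a left edge of some
    rhombus, since [strip_perm] makes entries exits. *)
Lemma is_edge_exit y i : is_edge y i ->
  y = right_end R i \/ exists2 f, in_face i f & y = exit T i f.
Proof.
move=> [f fi [yE|yE]]; last by right; exists f.
have : y \in right_end R i :: map (exit T i) (strip i).
  by rewrite mem_exits yE in_cons map_f ?orbT // mem_strip.
rewrite in_cons => /predU1P[->|/mapP[g]]; first by left.
by rewrite mem_strip => gi ->; right; exists g.
Qed.

Lemma is_edge_right i : is_edge (right_end R i) i.
Proof.
have := mem_exits i (right_end R i); rewrite mem_head in_cons (negPf (right_neq_left i)) /=.
by move/esym/mapP => [f]; rewrite mem_strip => fi fE; exists f => //; left.
Qed.

Lemma is_edge_left i : is_edge (left_end R i) i.
Proof.
have := mem_exits i (left_end R i); rewrite mem_head in_cons eq_sym (negPf (right_neq_left i)) /=.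
by move/mapP => [f]; rewrite mem_strip => fi fE; exists f => //; right.
Qed.

Lemma right_endS i j : j = i.+1 :> nat -> right_end R j = right_end R i + e i.
Proof.
move=> ji; rewrite /right_end (bigD1 i) ?ji ?ltnSn //= addrC; congr (_ + _).
by apply: eq_bigl => l; rewrite ltnS [in RHS]ltn_neqAle andbC.
Qed.

Lemma left_endS i j : j = i.+1 :> nat -> left_end R i = left_end R j + e j.
Proof.
move=> ji; rewrite /left_end (bigD1 j) ?ji ?ltnSn //= addrC; congr (_ + _).
by apply: eq_bigl => l; rewrite -val_eqE /=; lia.
Qed.

Lemma label_right i : label (right_end R i) = [set x : 'I_n | (x < i)%N]%SET.
Proof.
case: i => m mn; elim: m mn => [|m IH] mn.
  have -> : right_end R (Ordinal mn) = 0 by rewrite /right_end big1.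
  by rewrite /label label0 //; apply/setP => x; rewrite !inE.
have mn' := ltnW mn; rewrite (@right_endS (Ordinal mn')) //.
rewrite (proj2 (label_edge (is_edge_right _))) IH; apply/setP => x.
by rewrite !inE -val_eqE /=; lia.
Qed.

Lemma label_left i : label (left_end R i) = [set x : 'I_n | (i < x)%N]%SET.
Proof.
move: {2}(n - i)%N (leqnn (n - i)) => N; elim: N i => [|N IH] i iN.
  by have := ltn_ord i; rewrite ltnNge -subn_eq0 -leqn0 iN.
have [im|im] := ltnP i.+1 n; last first.
  have h (x : 'I_n) : (i < x)%N = false by have := ltn_ord x; lia.
  have -> : left_end R i = 0 by rewrite /left_end big1 // => x; rewrite h.
  by rewrite /label label0 //; apply/setP => x; rewrite !inE h.
rewrite (@left_endS i (Ordinal im)) // (proj2 (label_edge (is_edge_left _))) IH /=; last lia.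
by apply/setP => x; rewrite !inE -val_eqE /=; lia.
Qed.

(** Only the case of the lowest vertex x of a rhombus f = R_jk needs an argument.
    Unless x is on the right boundary, the edge from x to x + e_j is a left
    edge of a rhombus g of the strip j. Either x is the left corner of g, or x
    is the lowest vertex of g, whose first direction is smaller than j. *)
Lemma down_edge x : is_vertex T x -> x != 0 -> exists y i, is_edge y i /\ x = y + e i.
Proof.
move=> [f [a [b ->]]]; case: a.
  move=> _; exists (corner_pt T f false b), (fst_dir f); rewrite corner_fst.
  by split=> //; exact: is_edge_fst.
case: b.
  move=> _; exists (corner_pt T f false false), (snd_dir f); rewrite corner_snd.
  by split=> //; exact: is_edge_snd.
move: {2}(fst_dir f : nat) (leqnn (fst_dir f)) => N; elim: N f => [|N IH] f fN x0.
  all: have := is_edge_fst f false; move=> /is_edge_exit[xr|[g /in_faceP[gi|gi] xE]].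
  1, 4: have [i0|i0] := posnP (fst_dir f);
    first by move: x0; rewrite xr /right_end big1 ?eqxx // => l; rewrite i0.
  - by move: fN; rewrite leqNgt i0.
  - have pn : ((fst_dir f).-1 < n)%N by rewrite (leq_ltn_trans (leq_pred _)) ?ltn_ord.
    exists (right_end R (Ordinal pn)), (Ordinal pn); split; first exact: is_edge_right.
    by rewrite xr; apply: right_endS; rewrite /= prednK.
  1, 3: exists (corner_pt T g false false), (snd_dir g); rewrite corner_snd -exit_fst -gi -xE;
    by split=> //; exact: is_edge_snd.
  all: rewrite gi exit_snd in xE; have := face_lt g; rewrite -gi => gf.
    by have := leq_trans gf fN.
  rewrite xE in x0 *; apply: IH => //.
  by rewrite -ltnS (leq_trans gf).
Qed.

Lemma monotone_walk x : is_vertex T x ->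
  exists2 s, walk_to T x s & size s = #|label x|.
Proof.
move: {2}#|label x| (leqnn #|label x|) => N; elim: N x => [|N IH] x xN xv.
  all: have [x0|x0] := eqVneq x 0; first by exists [::];
    [split=> // | rewrite x0 /label label0 // cards0].
  all: have [y [i [yi xE]]] := down_edge xv x0; have [iy lx] := label_edge yi.
  all: rewrite -xE in lx; have cx : #|label x| = #|label y|.+1 by rewrite lx cardsU1 iy.
  by rewrite cx in xN.
have [|s [ps ls] sy] := IH y _ (proj1 (is_edge_vertex yi)); first by rewrite -ltnS -cx.
exists (rcons s x); last by rewrite size_rcons sy cx.
split; last by rewrite last_rcons.
rewrite rcons_path ps ls /=; apply/asboolP; rewrite xE; exact: is_edge_tiling_edge.
Qed.

Lemma dir_inj j k : e j = e k -> j = k.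
Proof.
move=> jk; apply/eqP/negPn/negP => /(cross_dir_neq0 R).
by rewrite jk crossuu eqxx.
Qed.

(** Each edge adds its direction to the label or removes it from the label. *)
Lemma walk_bound y s : path (fun y z => `[< tiling_edge T y z >]) y s ->
  (#|label (last y s)| <= #|label y| + size s)%N /\
  ((#|label (last y s)| = #|label y| + size s)%N ->
   label y \subset label (last y s) /\
   forall j, (exists2 m, (m < size s)%N & nth 0 s m = nth 0 (y :: s) m + e j) <->
     j \in (label (last y s) :\: label y)%SET).
Proof.
elim: s y => [|z s IH] y /=.
  move=> _; rewrite addn0; split=> // _; split=> // j; rewrite finset.setDv inE; split=> // -[] //.
move=> /andP[/asboolP/tiling_edgeP[i yz] /IH[le_z eq_z]].
have nth_step j :
    (exists2 m, (m < (size s).+1)%N & nth 0 (z :: s) m = nth 0 (y :: z :: s) m + e j) <->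
    z = y + e j \/ exists2 m, (m < size s)%N & nth 0 s m = nth 0 (z :: s) m + e j.
  split=> [[[|m] ms E]|[E|[m ms E]]]; first by left.
  - by right; exists m.
  - by exists 0%N.
  - by exists m.+1.
case: yz => -[/label_edge[iN lE] zE]; rewrite -zE in lE.
  have cz : #|label z| = #|label y|.+1 by rewrite lE cardsU1 iN.
  split; first by rewrite addnS -addSn -cz.
  move=> E; have {eq_z}[|sub steps] := eq_z; first by rewrite E addnS -addSn -cz.
  rewrite lE in sub steps; split; first by apply: fintype.subset_trans sub; exact: finset.subsetUr.
  move=> j; rewrite nth_step steps !finset.in_setD in_setU1 negb_or.
  split=> [[zj|/andP[/andP[_ ->] ->]]//|].
    have -> : j = i by apply: dir_inj; apply: (addrI y); rewrite -zj zE.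
    by rewrite iN (fintype.subsetP sub) // finset.setU11.
  move=> /andP[jy jl]; have [->|ji] := eqVneq j i; first by left.
  by right; rewrite jy jl.
have cy : #|label y| = #|label z|.+1 by rewrite lE cardsU1 iN.
split; first by apply: leq_trans le_z _; rewrite cy leq_add.
by move=> E; move: le_z; rewrite E cy addSn addnS ltnNge leqnSn.
Qed.

(** By [walk_bound] and [monotone_walk], the shortest walks from 0 to x are those of
    length #|label x|, and each step of theirs adds a direction to the
    label. *)
Lemma vertex_setE (v : vertex T) : vertex_set v = label (sval v).
Proof.
case: v => x xv /=; have [s0 w0 s0x] := monotone_walk xv.
have l0 : label 0 = finset.set0 by exact: label0.
have bound s : walk_to T x s -> (#|label x| <= size s)%N.
  by move=> [/walk_bound[h _] lx]; move: h; rewrite lx l0 cards0.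
have steps s : walk_to T x s -> size s = #|label x| ->
    forall j, has_step s (e j) <-> j \in label x.
  move=> [/walk_bound[_ h] lx] sx j; rewrite lx l0 cards0 in h.
  by have [|_ /(_ j)] := h; [rewrite sx | rewrite finset.setD0].
apply/setP => j; rewrite inE; apply/asboolP/idP => [[s [ws smin] js]|jx].
  apply/(steps s) => //; apply/eqP; rewrite eqn_leq bound // andbT -s0x.
  exact: smin.
exists s0; last exact/(steps s0).
by split=> // s' /bound; rewrite s0x.
Qed.

End Walks.

(** * Hermitian networks *)

Section Networks.
Variables (R : realType) (n : nat) (hn : (2 <= n)%N).
Variables (K : numFieldType) (cj : {rmorphism K -> K}) (cjK : involutive cj).
Hypothesis normE : forall x : K, `|x| ^+ 2 = x * cj x.
Hypothesis realE : forall x : K, x \is Num.real <-> cj x = x.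
Variable A : 'M[K]_n.
Hypothesis genA : generic A.
Implicit Types (T : tiling R n) (f : face n) (S : {set 'I_n}).

Let A_nz S : minor A S S != 0. Proof. by case: genA. Qed.

Lemma vertex_set_corner T f (a b : bool) (S := label T (pos T f)) :
  vertex_set (corner T f a b) =
  ((if b then [set snd_dir f] else finset.set0) :|:
     ((if a then [set fst_dir f] else finset.set0) :|: S))%SET.
Proof.
rewrite vertex_setE //=; apply/setP => i; rewrite label_corner // !finset.in_setU.
have [jS kS] := label_posN hn T f.
have fs : (fst_dir f == snd_dir f) = false by rewrite eq_sym snd_fst.
have [->|ij] := eqVneq i (fst_dir f).
  by rewrite (negPf jS); case: a; case: b;
    rewrite ?finset.in_set1 ?finset.in_set0 ?eqxx ?fs ?orbT.
have [->|ik] := eqVneq i (snd_dir f).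
  by rewrite (negPf kS); case: a; case: b;
    rewrite ?finset.in_set1 ?finset.in_set0 ?eqxx ?snd_fst ?orbT.
by case: a; case: b; rewrite ?finset.in_set1 ?finset.in_set0 ?(negPf ij) ?(negPf ik).
Qed.

Lemma sign_real (m : nat) (x : K) : (-1) ^+ m * x \is Num.real <-> x \is Num.real.
Proof.
rewrite !realE rmorphM rmorph_sign; split=> [/(congr1 (GRing.mul ((-1) ^+ m)))|->//].
by rewrite !mulrA -!expr2 !sqrr_sign !mul1r.
Qed.

Let real_minor S : Prop := cj (minor A S S) = minor A S S.

(** The vertices S and S + j + k of a face have opposite signs sigma, while those
    of S + j and S + k are equal: this gives the condition of
    [face_conditionP]. *)
Lemma hermitian_networkP T : hermitian_network (@network_of R K n A T) <->
  (forall x, is_vertex T x -> real_minor (label T x)) /\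
  (forall f, let S := label T (pos T f) in
     schur A S (fst_dir f) (snd_dir f) = cj (schur A S (snd_dir f) (fst_dir f))).
Proof.
pose F := @network_of R K n A T.
have real : (forall v : vertex T, F (inl v) \is Num.real) <->
    forall x, is_vertex T x -> real_minor (label T x).
  split=> [h x xv|h v].
    by have /sign_real/realE := h (exist _ x xv); rewrite vertex_setE.
  apply/sign_real/realE; rewrite vertex_setE //; exact: h (svalP v).
rewrite /hermitian_network real.
suff face f : (forall x, is_vertex T x -> real_minor (label T x)) ->
    let S := label T (pos T f) in
    `|F (inr f)| ^+ 2 =
       F (inl (corner T f false false)) * F (inl (corner T f true true)) +
       F (inl (corner T f true false)) * F (inl (corner T f false true)) <->
    schur A S (fst_dir f) (snd_dir f) = cj (schur A S (snd_dir f) (fst_dir f)).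
  split=> -[h1 h2]; split=> // f; have [F1 F2] := face f h1; first exact: F1 (h2 f).
  exact: F2 (h2 f).
move=> h S; have [jS kS] := label_posN hn T f; rewrite -/S in jS kS.
have jk : fst_dir f != snd_dir f by rewrite eq_sym snd_fst.
have rS : cj (minor A S S) = minor A S S.
  by apply: h; exists f, false, false; exact: pos_corner.
rewrite -(face_conditionP cjK normE genA jk jS kS rS) /=.
rewrite /sigma !vertex_set_corner /= -/S !finset.set0U.
have kjS : snd_dir f \notin fst_dir f |: S by rewrite in_setU1 negb_or eq_sym jk.
rewrite !cardsU1 kjS jS kS /= !add1n normrM normr_sign mul1r.
have -> : (#|S|.+2 %/ 2 = (#|S| %/ 2).+1)%N by lia.
set p := (_ %/ 2)%N; set q := (_ %/ 2)%N.
have sq (m : nat) (x y : K) : (-1) ^+ m * x * ((-1) ^+ m * y) = x * y.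
  by rewrite mulrACA -expr2 sqrr_sign mul1r.
by rewrite [(-1) ^+ p.+1]exprS mulN1r mulNr mulrN !sq addrC.
Qed.

Lemma hermitian_all_networks T : adjoint cj A = A ->
  hermitian_network (@network_of R K n A T).
Proof.
move=> hA; apply/hermitian_networkP; split=> [x _|f S].
  by rewrite /real_minor -minor_adjoint hA.
have [jS kS] := label_posN hn T f.
by rewrite -{1}hA (schur_adjoint cjK).
Qed.

Lemma hermitian_of_network T : hermitian_network (@network_of R K n A T) ->
  adjoint cj A = A.
Proof.
move=> /hermitian_networkP[real face].
pose edge B i := exists2 y, is_edge T y i & label T y = B.
have diag y i : is_edge T y i -> cj (schur A (label T y) i i) = schur A (label T y) i i.
  move=> yi; have [v1 v2] := is_edge_vertex yi; have [iN lE] := label_edge hn yi.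
  have := real _ v2; rewrite /real_minor lE minorU1 // rmorphM /= (real _ v1).
  by move/(mulfI (A_nz _)).
apply: (hermitian_of_sweep cjK A_nz (edge := edge)).
- move=> B i [y yi <-]; case/is_edge_exit: (yi) => // [->|[f fi yE]].
    by left; rewrite label_right.
  right; exists (label T (pos T f)), (fst_dir f), (snd_dir f).
  have [jS kS] := label_posN hn T f.
  have ej := is_edge_fst T f false; have ek := is_edge_snd T f false.
  rewrite -pos_corner in ej ek.
  split=> //; [exact: face_lt | by split; [exact: face | exact: diag | exact: diag] | |].
    split; first by exists (pos T f).
    exists (pos T f + dir R (fst_dir f)); last by case: (label_edge hn ej).
    by rewrite pos_corner corner_fst; exact: is_edge_snd.
  case/in_faceP: fi yE => ->; rewrite ?exit_fst ?exit_snd => ->; [left | right]; split=> //.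
    rewrite -corner_snd -pos_corner.
    by case: (label_edge hn ek).
  by rewrite -pos_corner.
- by move=> i; exists (left_end R i); [exact: is_edge_left | exact: label_left].
- by move=> i; rewrite -(label_right hn T i); apply: diag; exact: is_edge_right.
Qed.

Lemma hermitian_tfae : [<-> adjoint cj A = A;
  exists T : tiling R n, hermitian_network (@network_of R K n A T);
  forall T : tiling R n, hermitian_network (@network_of R K n A T)].
Proof.
have [T0 _] := std_tiling_exists R hn.
tfae=> [hA|[T hT] T'|hT].
- by exists T0; exact: hermitian_all_networks.
- exact/hermitian_all_networks/(hermitian_of_network hT).
- exact: hermitian_of_network (hT T0).
Qed.

End Networks.

Lemma symmetricmx_adjoint (R : realType) n (A : 'M[R]_n) :
  adjoint idfun A = A <-> A \is symmetricmx.
Proof.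
rewrite is_hermitianmxE expr0 scale1r; split=> [E|/eqP E].
  by apply/eqP; rewrite -{1}E /adjoint map_trmx.
by rewrite /adjoint map_trmx -E.
Qed.

Lemma hermsymmx_adjoint (C : numClosedFieldType) n (A : 'M[C]_n) :
  adjoint Num.conj A = A <-> A \is hermsymmx.
Proof.
rewrite is_hermitianmxE expr0 scale1r; split=> [E|/eqP E].
  by apply/eqP; rewrite -{1}E /adjoint map_trmx.
by rewrite /adjoint map_trmx -E.
Qed.

Theorem theorem5p2 (R : realType) (n : nat) (hn : (2 <= n)%N) :
  (forall A : 'M[R]_n, generic A ->
     [<-> A \is symmetricmx;
          exists T : tiling R n, hermitian_network (@network_of R R n A T);
          forall T : tiling R n, hermitian_network (@network_of R R n A T)]) /\
  (forall A : 'M[R[i]]_n, generic A ->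
     [<-> A \is hermsymmx;
          exists T : tiling R n, hermitian_network (@network_of R R[i] n A T);
          forall T : tiling R n, hermitian_network (@network_of R R[i] n A T)]).
Proof.
split=> A genA.
  have H : [<-> adjoint idfun A = A;
      exists T : tiling R n, hermitian_network (@network_of R R n A T);
      forall T : tiling R n, hermitian_network (@network_of R R n A T)].
    apply: hermitian_tfae => // x; first by rewrite real_normK ?num_real // expr2.
    by split=> // _; exact: num_real.
  by tfae=> [/symmetricmx_adjoint/(H 0 1)%N|/(H 1 2)%N|/(H 2 0)%N/symmetricmx_adjoint].
have H : [<-> adjoint Num.conj A = A;
    exists T : tiling R n, hermitian_network (@network_of R R[i] n A T);
    forall T : tiling R n, hermitian_network (@network_of R R[i] n A T)].
  apply: hermitian_tfae => // [x|x|x]; first exact: conjCK.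
    exact: normCK.
  by rewrite CrealE; split=> /eqP.
by tfae=> [/hermsymmx_adjoint/(H 0 1)%N|/(H 1 2)%N|/(H 2 0)%N/hermsymmx_adjoint].
Qed.
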